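(* As $\varepsilon\to0$, for the approximation of the smallest eigenvalue $\lambda(q)$, $q\in\mathbf{Q}$, in the (deterministic) worst case setting, $$n^{\mathrm{wor}}(\varepsilon)=\Theta(\varepsilon^{-1/2}),$$ and $$\mathrm{comp}^{\mathrm{wor}}(\varepsilon)=\Omega(\mathbf{c}\,\varepsilon^{-1/2}),\qquad \mathrm{comp}^{\mathrm{wor}}(\varepsilon)=O\left(\mathbf{c}\,\varepsilon^{-1/2}+\varepsilon^{-1/2}\log\varepsilon^{-1}\right).$$
   Context: $\mathbf{Q}$ is the class of functions $q:[0,1]\to[0,1]$ with $q\in C^2([0,1])$ and $\max_{i=0,1,2}\max_{x\in[0,1]}|q^{(i)}(x)|\le 1$. For $q\in\mathbf{Q}$, $\lambda(q)$ is the smallest eigenvalue of $-u''+qu=\lambda u$ on $(0,1)$, $u(0)=u(1)=0$. Deterministic algorithms: $\phi(q)=\phi(q(t_1),\dots,q(t_{n_q}))$, based on values of $q$ at points $t_i\in[0,1]$ that may be chosen adaptively, $t_i=t_i(t_1,q(t_1),\dots,t_{i-1},q(t_{i-1}))$ for $i\ge2$; the number $n_q$ may also be chosen adaptively. Let $n=\sup_{q\in\mathbf{Q}}n_q$, assumed finite. The worst case error is $e^{\mathrm{wor}}(\phi,n)=\sup_{q\in\mathbf{Q}}|\lambda(q)-\phi(q)|$, and $n^{\mathrm{wor}}(\varepsilon)=\min\{n:\exists\,\phi\text{ with }e^{\mathrm{wor}}(\phi,n)\le\varepsilon\}$. Cost (real number model with oracle): arithmetic operations (addition, subtraction, multiplication,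 division, evaluation of elementary functions) and comparisons of real numbers are performed exactly at unit cost; one evaluation of $q$ costs $\mathbf{c}>0$. The cost of $\phi$ is $\mathrm{cost}^{\mathrm{wor}}(\phi)=\sup_{q\in\mathbf{Q}}(\mathbf{c}\,n_q+m_q)$, where $m_q$ is the number of operations used for $q$. The complexity is $\mathrm{comp}^{\mathrm{wor}}(\varepsilon)=\min\{\mathrm{cost}^{\mathrm{wor}}(\phi):e^{\mathrm{wor}}(\phi,n)\le\varepsilon\}$. $\log=\log_2$. The constants in the $O,\Omega,\Theta$ notation are independent of $\varepsilon$ and $\mathbf{c}$. *)

(* Defs.v *)
From Stdlib Require Export Reals List.
From Stdlib Require Import ClassicalEpsilon.
From Coquelicot Require Export Coquelicot.
Export ListNotations.
Open Scope R_scope.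

Definition unit_interval (x : R) : Prop := 0 <= x <= 1.

(** Functions on [0,1] are represented by functions on [R] whose values outside
    [0,1] never matter; [D_in] and [continue_in] are taken relative to [0,1],
    so the derivatives are one-sided at 0 and 1. *)
Definition C2_with (f f1 f2 : R -> R) : Prop :=
  forall x, unit_interval x ->
    D_in f f1 unit_interval x /\
    D_in f1 f2 unit_interval x /\
    continue_in f2 unit_interval x.

Definition classQ (q : R -> R) : Prop :=
  (forall x, unit_interval x -> unit_interval (q x)) /\
  exists q1 q2 : R -> R,
    C2_with q q1 q2 /\
    forall x, unit_interval x ->
      Rabs (q x) <= 1 /\ Rabs (q1 x) <= 1 /\ Rabs (q2 x) <= 1.

Definition is_eigenvalue (q : R -> R) (l : R) : Prop :=
  exists u u1 u2 : R -> R,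
    C2_with u u1 u2 /\
    (forall x, 0 < x < 1 -> - u2 x + q x * u x = l * u x) /\
    u 0 = 0 /\ u 1 = 0 /\
    exists x, unit_interval x /\ u x <> 0.

Definition is_smallest_eigenvalue (q : R -> R) (l : R) : Prop :=
  is_eigenvalue q l /\ forall m, is_eigenvalue q m -> l <= m.

Definition lambda (q : R -> R) : R :=
  epsilon (inhabits 0) (is_smallest_eigenvalue q).

(** [phi q v] means that the value computed for [q] is [v]. *)
Definition worst_error (phi : (R -> R) -> R -> Prop) : Rbar :=
  Lub_Rbar (fun e => exists q v, classQ q /\ phi q v /\ e = Rabs (lambda q - v)).

(** [next] and [stop] receive the chronological list of the pairs
    (t_1, q(t_1)), ..., (t_i, q(t_i)) obtained so far.  No computability is
    required of [next], [stop] and [combine]. *)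
Record algorithm := Algorithm {
  next : list (R * R) -> R;
  next_unit : forall h, unit_interval (next h);
  stop : list (R * R) -> bool;
  combine : list R -> R
}.

Fixpoint history (A : algorithm) (q : R -> R) (k : nat) : list (R * R) :=
  match k with
  | O => []
  | S k' => let h := history A q k' in h ++ [(next A h, q (next A h))]
  end.

Definition evaluations (A : algorithm) (q : R -> R) (n : nat) : Prop :=
  stop A (history A q n) = true /\
  forall k, (k < n)%nat -> stop A (history A q k) = false.

Definition alg_value (A : algorithm) (q : R -> R) (v : R) : Prop :=
  exists n, evaluations A q n /\ v = combine A (map snd (history A q n)).

(** n = sup_q n_q; a finite supremum of natural numbers is attained. *)
Definition is_sup_evaluations (A : algorithm) (n : nat) : Prop :=
  (forall q, classQ q -> exists k, (k <= n)%nat /\ evaluations A q k) /\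
  exists q, classQ q /\ evaluations A q n.

(** The minimum, being over natural numbers, is the greatest lower bound of the
    set when the set is nonempty; it is [p_infty] when the set is empty. *)
Definition nwor (eps : R) : Rbar :=
  Glb_Rbar (fun r => exists (A : algorithm) (n : nat),
    is_sup_evaluations A n /\ Rbar_le (worst_error (alg_value A)) eps /\
    r = INR n).

(** Real number model: a program is a finite computation tree working on real registers indexed by
    [nat], with arbitrary real constants.  Since the tree may depend on the
    accuracy and its size is not charged, loops are unrolled.  Branching is
    by comparison only, and the answer of the oracle is merely stored in a
    register, so that every use made of it is charged. *)
Inductive operand := Reg (i : nat) | Cst (a : R).

Inductive arith := Add | Sub | Mul | Div.

(** Other elementary functions are compositions of boundedly many operations
    on this list. *)
Inductive elementary := Sqrt | Exp | Ln | Sin | Cos | Atan.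

Inductive program :=
  | Return (a : operand)
  | Arith (o : arith) (dst : nat) (a b : operand) (k : program)
  | Elem (f : elementary) (dst : nat) (a : operand) (k : program)
  | Query (dst : nat) (t : operand) (k : program)
  | IfLe (a b : operand) (kle kgt : program).

Definition memory := nat -> R.

Definition read (s : memory) (a : operand) : R :=
  match a with Reg i => s i | Cst x => x end.

Definition write (s : memory) (i : nat) (x : R) : memory :=
  fun j => if Nat.eqb j i then x else s j.

Definition arith_val (o : arith) (x y : R) : R :=
  match o with Add => x + y | Sub => x - y | Mul => x * y | Div => x / y end.

Definition arith_def (o : arith) (y : R) : Prop :=
  match o with Div => y <> 0 | _ => True end.

Definition elem_val (f : elementary) (x : R) : R :=
  match f with
  | Sqrt => sqrt x | Exp => exp x | Ln => ln x
  | Sin => sin x | Cos => cos x | Atan => atan x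
  end.

Definition elem_def (f : elementary) (x : R) : Prop :=
  match f with Sqrt => 0 <= x | Ln => 0 < x | _ => True end.

Record outcome := Outcome { value : R; queries : nat; operations : nat }.

Definition add_query (r : outcome) : outcome :=
  Outcome (value r) (S (queries r)) (operations r).

Definition add_operation (r : outcome) : outcome :=
  Outcome (value r) (queries r) (S (operations r)).

Fixpoint exec (P : program) (q : R -> R) (s : memory) : outcome :=
  match P with
  | Return a => Outcome (read s a) 0 0
  | Arith o d a b k =>
      add_operation (exec k q (write s d (arith_val o (read s a) (read s b))))
  | Elem f d a k =>
      add_operation (exec k q (write s d (elem_val f (read s a))))
  | Query d t k => add_query (exec k q (write s d (q (read s t))))
  | IfLe a b kle kgt =>
      add_operation
        (if Rle_dec (read s a) (read s b) then exec kle q s else exec kgt q s)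
  end.

(** Every operation performed on input [q] is defined, and [q] is evaluated
    only at points of [0,1]. *)
Fixpoint safe (P : program) (q : R -> R) (s : memory) : Prop :=
  match P with
  | Return a => True
  | Arith o d a b k =>
      arith_def o (read s b) /\
      safe k q (write s d (arith_val o (read s a) (read s b)))
  | Elem f d a k =>
      elem_def f (read s a) /\ safe k q (write s d (elem_val f (read s a)))
  | Query d t k =>
      unit_interval (read s t) /\ safe k q (write s d (q (read s t)))
  | IfLe a b kle kgt =>
      if Rle_dec (read s a) (read s b) then safe kle q s else safe kgt q s
  end.

Definition init : memory := fun _ => 0.

Definition run (P : program) (q : R -> R) : outcome := exec P q init.

Definition valid (P : program) : Prop :=
  forall q, classQ q -> safe P q init.

Definition prog_value (P : program) (q : R -> R) (v : R) : Prop :=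
  v = value (run P q).

Definition cost_wor (c : R) (P : program) : Rbar :=
  Lub_Rbar (fun r => exists q, classQ q /\
    r = c * INR (queries (run P q)) + INR (operations (run P q))).

(** For [c > 0] the costs are of the form c n + m with n, m natural, so the
    greatest lower bound of a nonempty set of costs is a minimum. *)
Definition comp_wor (c eps : R) : Rbar :=
  Glb_Rbar (fun r => exists P : program,
    valid P /\ Rbar_le (worst_error (prog_value P)) eps /\
    cost_wor c P = Finite r).

Definition log2 (x : R) : R := ln x / ln 2.

(* Main.v *)
Require Import Defs.
From Stdlib Require Import Lra Lia Classical ClassicalEpsilon
  FunctionalExtensionality.

(** The smallest eigenvalue is characterised by an eigenfunction positive on
    (0,1), obtained by shooting: it is the supremum of the [m] for which the
    solution of [y'' = (q - m) y], [y(0) = 0], [y'(0) = 1] is positive on (0,1].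
    The Wronskian of two such eigenfunctions [u], [w] for the potentials [q], [r]
    gives [(lambda r - lambda q) int u w = int (r - q) u w], hence
    [|lambda q - lambda r| <= max |q - r|].

    Upper bounds: two elements of [Q] that are [e]-close at the points [i/n] are
    [(e + 1/(4 n^2))]-close on [0,1], so [n = O(eps^(-1/2))] samples, each known up
    to [eps/4], determine [lambda q] up to [eps].  In the tree model each sample is
    rounded by bisection against constants, with [O(log (1/eps))] comparisons, and
    the leaf reached by the rounded data returns, as a constant, the eigenvalue
    of some potential consistent with them.

    Lower bounds: if the zero potential is sampled at [n] points, split [1/4,3/4] into
    [2(n+1)] cells of length [h] and put a bump of height of order [h^2] on each of
    the at least [n+2] cells without sample in their interior.  The resulting
    potential has the same samples.
    Eigenfunctions are concave, hence at least a quarter of their maximum on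
    [1/4,3/4], and the Wronskian identity shows that the eigenvalue moved by a
    constant times [h^2]. *)

(** * One-sided derivatives and extension to the line *)

(** The retraction of the line onto [0,1]. Composing with it turns continuity relative to [0,1] into
    continuity on the whole line. *)
Definition clamp (x : R) : R := Rmax 0 (Rmin 1 x).

Lemma clamp_unit (x : R) : unit_interval (clamp x).
Proof.
unfold clamp, unit_interval, Rmax, Rmin.
destruct (Rle_dec 1 x); destruct (Rle_dec _ _); lra.
Qed.

Lemma clamp_id (x : R) : unit_interval x -> clamp x = x.
Proof.
unfold clamp, unit_interval, Rmax, Rmin; intros H.
destruct (Rle_dec 1 x); destruct (Rle_dec _ _); lra.
Qed.

Lemma clamp_lipschitz (x y : R) : Rabs (clamp x - clamp y) <= Rabs (x - y).
Proof.
unfold clamp, Rmax, Rmin.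
destruct (Rle_dec 1 x); destruct (Rle_dec 1 y); repeat destruct (Rle_dec _ _);
  unfold Rabs; repeat destruct (Rcase_abs _); lra.
Qed.

Lemma continuous_eps (f : R -> R) (x : R) :
  (forall e, 0 < e -> exists d, 0 < d /\
     forall y, Rabs (y - x) < d -> Rabs (f y - f x) < e) ->
  continuous f x.
Proof.
intros H; apply continuity_pt_filterlim.
intros e He; destruct (H e He) as [d [Hd H']]; exists d; split; [exact Hd|].
intros y [_ Hy]; apply H', Hy.
Qed.

Lemma continuous_continue_in (f : R -> R) (D : R -> Prop) (x : R) :
  continuous f x -> continue_in f D x.
Proof.
intros H e He.
apply continuity_pt_filterlim in H.
destruct (H e He) as [d [Hd H']]; exists d; split; [exact Hd|].
intros y [[_ Hne] Hy]; apply H'.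
split; [split; [exact I|exact Hne]|exact Hy].
Qed.

Lemma continuous_clamp_comp (f : R -> R) (x : R) :
  (forall y, unit_interval y -> continue_in f unit_interval y) ->
  continuous (fun z => f (clamp z)) x.
Proof.
intros H; apply continuous_eps; intros e He.
destruct (H (clamp x) (clamp_unit x) e He) as [d [Hd H']].
exists d; split; [exact Hd|]; intros y Hy.
destruct (Req_dec (clamp x) (clamp y)) as [E|E].
  rewrite <- E, Rminus_diag, Rabs_R0; exact He.
apply (H' (clamp y)); split.
  split; [apply clamp_unit|exact E].
apply Rle_lt_trans with (2 := Hy), clamp_lipschitz.
Qed.

Lemma D_in_continue_in (f f1 : R -> R) (D : R -> Prop) (x : R) :
  D_in f f1 D x -> continue_in f D x.
Proof. apply cont_deriv. Qed.

Lemma D_in_is_derive (f f1 : R -> R) (x : R) :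
  0 < x < 1 -> D_in f f1 unit_interval x -> is_derive f x (f1 x).
Proof.
intros Hx H; apply is_derive_Reals; intros e He.
destruct (H e He) as [d [Hd H']].
assert (Hm : 0 < Rmin d (Rmin x (1 - x))) by (repeat apply Rmin_glb_lt; lra).
exists (mkposreal _ Hm); simpl; intros h Hh0 Hh.
assert (H1 := Rmin_l d (Rmin x (1 - x))).
assert (H2 := Rmin_r d (Rmin x (1 - x))).
assert (H3 := Rmin_l x (1 - x)).
assert (H4 := Rmin_r x (1 - x)).
assert (Hh2 := Rabs_def2 _ _ Hh).
specialize (H' (x + h)).
simpl in H'; unfold R_dist in H'.
replace (x + h - x) with h in H' by ring.
apply H'; split; [split|]; unfold unit_interval; lra.
Qed.

Lemma is_derive_D_in (f f1 : R -> R) (D : R -> Prop) (x : R) :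
  is_derive f x (f1 x) -> D_in f f1 D x.
Proof.
intros H; apply is_derive_Reals in H; intros e He.
destruct (H e He) as [d H']; exists d; split; [apply cond_pos|].
intros y [[_ Hne] Hy]; simpl in *; unfold R_dist in *.
replace (f y) with (f (x + (y - x))) by (f_equal; ring).
apply H'; [lra|exact Hy].
Qed.

Lemma continuous_is_derive (f : R -> R) (x l : R) :
  is_derive f x l -> continuous f x.
Proof. intros H; apply (ex_derive_continuous f); exists l; exact H. Qed.

Lemma is_derive_RInt_continuous (f : R -> R) (c a x : R) :
  (forall y, continuous f y) ->
  is_derive (fun z => c + RInt f a z) x (f x).
Proof.
intros H.
replace (f x) with (0 + f x) by ring.
apply (is_derive_plus (fun _ => c)); [apply is_derive_Reals, derivable_pt_lim_const|].
apply (is_derive_RInt f _ a); [|apply H].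
exists (mkposreal 1 Rlt_0_1); intros y _.
apply (@RInt_correct R_CompleteNormedModule), (@ex_RInt_continuous R_CompleteNormedModule); intros; apply H.
Qed.

(** The difference has zero derivative on (0,1). As [f] has only one-sided derivatives at 0 and 1,
    the mean value theorem is applied with [f (clamp z)], which is continuous on the line and equals
    [f] on [0,1]. *)
Lemma primitive_unique_in (f f1 g g1 : R -> R) :
  (forall x, unit_interval x -> D_in f f1 unit_interval x) ->
  (forall x, is_derive g x (g1 x)) ->
  (forall x, unit_interval x -> g1 x = f1 x) -> g 0 = f 0 ->
  forall x, unit_interval x -> g x = f x.
Proof.
intros Hf Hg E1 E0 x Hx.
assert (H01 : unit_interval 0) by (unfold unit_interval; lra).
destruct (MVT_gen (fun z => f (clamp z) - g z) 0 x (fun _ => 0)) as [c [_ Hc]].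
- intros y Hy; unfold unit_interval in Hx.
  rewrite Rmin_left, Rmax_right in Hy by lra.
  replace 0 with (f1 y - g1 y)
    by (rewrite E1 by (unfold unit_interval; lra); ring).
  apply (is_derive_minus (fun z => f (clamp z)) g); [|apply Hg].
  apply is_derive_ext_loc with f.
    assert (Hm : 0 < Rmin y (1 - y)) by (apply Rmin_glb_lt; lra).
    exists (mkposreal _ Hm); intros z Hz.
    apply Rabs_def2 in Hz; simpl in Hz.
    assert (H1 := Rmin_l y (1 - y)); assert (H2 := Rmin_r y (1 - y)).
    unfold minus, plus, opp in Hz; simpl in Hz.
    rewrite clamp_id; [reflexivity|unfold unit_interval; lra].
  apply D_in_is_derive; [lra|apply Hf; unfold unit_interval; lra].
- intros y _; apply continuity_pt_filterlim.
  apply (continuous_minus (fun z => f (clamp z)) g).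
    apply continuous_clamp_comp; intros z Hz.
    apply D_in_continue_in with f1, Hf, Hz.
  apply continuous_is_derive with (g1 y), Hg.
- rewrite (clamp_id x Hx), (clamp_id 0 H01) in Hc; lra.
Qed.

(** [f2] is extended by constants and integrated twice; uniqueness of primitives identifies the
    result with [f] on [0,1]. Two-sided derivatives then become available. *)
Lemma C2_with_extend (f f1 f2 : R -> R) :
  C2_with f f1 f2 ->
  exists g g1 g2 : R -> R,
    (forall x, is_derive g x (g1 x)) /\ (forall x, is_derive g1 x (g2 x)) /\
    (forall x, continuous g2 x) /\
    forall x, unit_interval x -> g x = f x /\ g1 x = f1 x /\ g2 x = f2 x.
Proof.
intros H.
set (g2 := fun x => f2 (clamp x)).
assert (C : forall x, continuous g2 x)
  by (intros x; apply continuous_clamp_comp; intros y Hy; apply H, Hy).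
set (g1 := fun x => f1 0 + RInt g2 0 x).
assert (D1 : forall x, is_derive g1 x (g2 x))
  by (intros x; apply is_derive_RInt_continuous, C).
assert (C1 : forall x, continuous g1 x)
  by (intros x; apply continuous_is_derive with (g2 x), D1).
set (g := fun x => f 0 + RInt g1 0 x).
assert (D : forall x, is_derive g x (g1 x))
  by (intros x; apply is_derive_RInt_continuous, C1).
assert (E2 : forall x, unit_interval x -> g2 x = f2 x)
  by (intros x Hx; unfold g2; rewrite clamp_id; auto).
assert (Z : forall (h : R -> R) c, c + RInt h 0 0 = c)
  by (intros h c; rewrite RInt_point; apply Rplus_0_r).
assert (E1 : forall x, unit_interval x -> g1 x = f1 x).
  apply primitive_unique_in with f2 g2; auto; [|apply Z].
  intros x Hx; apply H, Hx.
assert (E : forall x, unit_interval x -> g x = f x).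
  apply primitive_unique_in with f1 g1; auto; [|apply Z].
  intros x Hx; apply H, Hx.
exists g, g1, g2.
exact (conj D (conj D1 (conj C (fun x Hx => conj (E x Hx) (conj (E1 x Hx) (E2 x Hx)))))).

Qed.

(** * Existence for the initial value problem *)

Lemma mean_value (f f1 : R -> R) (a b : R) :
  a < b -> (forall x, a <= x <= b -> is_derive f x (f1 x)) ->
  exists c, f b - f a = f1 c * (b - a) /\ a < c < b.
Proof.
intros Hab H; apply MVT_cor2; [exact Hab|].
intros c Hc; apply is_derive_Reals, H, Hc.
Qed.

Lemma derive_nonneg_le (f f1 : R -> R) (a b : R) :
  a <= b -> (forall x, a <= x <= b -> is_derive f x (f1 x)) ->
  (forall x, a < x < b -> 0 <= f1 x) -> f a <= f b.
Proof.
intros [Hab| <-] H Hp; [|lra].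
destruct (mean_value f f1 a b Hab H) as [c [E Hc]].
specialize (Hp c Hc); assert (0 <= f1 c * (b - a)) by (apply Rmult_le_pos; lra).
lra.
Qed.

Lemma derive_pos_lt (f f1 : R -> R) (a b : R) :
  a < b -> (forall x, a <= x <= b -> is_derive f x (f1 x)) ->
  (forall x, a < x < b -> 0 < f1 x) -> f a < f b.
Proof.
intros Hab H Hp.
destruct (mean_value f f1 a b Hab H) as [c [E Hc]].
specialize (Hp c Hc); assert (0 < f1 c * (b - a)) by (apply Rmult_lt_0_compat; lra).
lra.
Qed.

(** Both [g - f] and [g + f] are nondecreasing. *)
Lemma derive_dominated (f f1 g g1 : R -> R) (a b : R) :
  a <= b ->
  (forall x, a <= x <= b -> is_derive f x (f1 x)) ->
  (forall x, a <= x <= b -> is_derive g x (g1 x)) ->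
  (forall x, a < x < b -> Rabs (f1 x) <= g1 x) ->
  Rabs (f b - f a) <= g b - g a.
Proof.
intros Hab Hf Hg H.
assert (H1 : g a - f a <= g b - f b).
  apply (derive_nonneg_le (fun x => g x - f x) (fun x => g1 x - f1 x)); auto.
    intros x Hx; apply (is_derive_minus g f); auto.
  intros x Hx; specialize (H x Hx); apply Rabs_le_between in H; lra.
assert (H2 : g a + f a <= g b + f b).
  apply (derive_nonneg_le (fun x => g x + f x) (fun x => g1 x + f1 x)); auto.
    intros x Hx; apply (is_derive_plus g f); auto.
  intros x Hx; specialize (H x Hx); apply Rabs_le_between in H; lra.
apply Rabs_le; lra.
Qed.

(** [y] is differentiable on the whole line, so that one-sided derivatives do not
    occur; the equation is required on [0,1] only. *)
Definition solution (p y y1 : R -> R) : Prop :=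
  y 0 = 0 /\ y1 0 = 1 /\ (forall x, is_derive y x (y1 x)) /\
  forall x, unit_interval x -> is_derive y1 x (p x * y x).

(** A geometric series dominates the increments, so the sequences are Cauchy with a rate uniform in
    [x]; continuity of the limit is the three-epsilon argument. *)
Lemma geometric_uniform_limit (w : nat -> R -> R) (E : R) :
  (forall n x, continuous (w n) x) ->
  (forall n x, Rabs (w (S n) x - w n x) <= E * (/ 2) ^ n) ->
  exists W, (forall x, continuous W x) /\
    forall n x, Rabs (W x - w n x) <= 2 * E * (/ 2) ^ n.
Proof.
intros Cw Hw.
assert (HE : 0 <= E).
  specialize (Hw 0%nat 0); assert (H := Rabs_pos (w 1%nat 0 - w 0%nat 0)).
  simpl in Hw; lra.
(* The factor [1 - (/ 2) ^ k] gives the exact partial sum of the geometric series, so that the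
   induction closes. *)
assert (Hnk : forall k n x,
  Rabs (w (n + k)%nat x - w n x) <= 2 * E * (/ 2) ^ n * (1 - (/ 2) ^ k)).
  induction k as [|k IH]; intros n x.
    rewrite Nat.add_0_r, Rminus_diag, Rabs_R0; simpl; lra.
  rewrite Nat.add_succ_r.
  replace (w (S (n + k)) x - w n x)
    with ((w (S (n + k)) x - w (n + k)%nat x) + (w (n + k)%nat x - w n x)) by ring.
  apply Rle_trans with (1 := Rabs_triang _ _).
  specialize (IH n x); specialize (Hw (n + k)%nat x).
  rewrite pow_add in Hw; simpl; lra.
assert (P2 : forall n, 0 < (/ 2) ^ n) by (intros n; apply pow_lt; lra).
assert (Hnk' : forall n k x, Rabs (w (n + k)%nat x - w n x) <= 2 * E * (/ 2) ^ n).
  intros n k x; apply Rle_trans with (1 := Hnk k n x).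
  assert (H1 := P2 n); assert (H2 := P2 k).
  assert (0 <= 2 * E * (/ 2) ^ n) by (apply Rmult_le_pos; lra).
  nra.
assert (Small : forall C e, 0 < e -> exists n, C * (/ 2) ^ n < e).
  intros C e He.
  destruct (pow_lt_1_zero (/ 2)) with (y := e / (Rabs C + 1)) as [N HN].
    rewrite Rabs_pos_eq; lra.
    apply Rdiv_lt_0_compat; [lra|]; assert (H := Rabs_pos C); lra.
  exists N; specialize (HN N (le_n N)).
  rewrite Rabs_pos_eq in HN by (apply Rlt_le, P2).
  assert (H := Rabs_pos C); assert (H' := Rle_abs C); specialize (P2 N).
  apply Rlt_div_r in HN; [|lra].
  nra.
assert (Lx : forall x, exists l, forall n, Rabs (l - w n x) <= 2 * E * (/ 2) ^ n).
  intros x.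
  assert (Hc : ex_finite_lim_seq (fun n => w n x)).
    apply ex_lim_seq_cauchy_corr; intros e.
    destruct (Small (4 * E) e (cond_pos e)) as [N HN].
    exists N; intros n m Hn Hm.
    assert (A := Hnk' N (n - N)%nat x); assert (B := Hnk' N (m - N)%nat x).
    replace (N + (n - N))%nat with n in A by lia.
    replace (N + (m - N))%nat with m in B by lia.
    apply Rabs_le_between in A; apply Rabs_le_between in B; apply Rabs_def1; lra.
  destruct Hc as [l Hl]; exists l; intros n.
  assert (Hl' : is_lim_seq (fun k => Rabs (w (k + n)%nat x - w n x)) (Rabs (l - w n x))).
    apply (is_lim_seq_abs _ (Finite (l - w n x))).
    apply (is_lim_seq_minus' (fun k => w (k + n)%nat x) (fun _ => w n x)).
      apply (is_lim_seq_incr_n (fun k => w k x)), Hl.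
    apply is_lim_seq_const.
  apply (is_lim_seq_le (fun k => Rabs (w (k + n)%nat x - w n x))
           (fun _ => 2 * E * (/ 2) ^ n) (Rabs (l - w n x)) (2 * E * (/ 2) ^ n)).
    intros k; rewrite Nat.add_comm; apply Hnk'.
    exact Hl'.
    apply is_lim_seq_const.
destruct (choice _ Lx) as [W HW].
exists W; split; [|intros; apply HW].
intros x; apply continuous_eps; intros e He.
destruct (Small (2 * E) (e / 3)) as [N HN]; [lra|].
assert (Cx := proj2 (continuity_pt_filterlim _ _) (Cw N x)).
destruct (Cx (e / 3)) as [d [Hd H]]; [lra|].
exists d; split; [exact Hd|]; intros y Hy.
assert (HwN : Rabs (w N y - w N x) < e / 3).
  destruct (Req_dec x y) as [<-|Hne]; [rewrite Rminus_diag, Rabs_R0; lra|].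
  apply H; split; [split; [exact I|exact Hne]|exact Hy].
assert (A := HW x N); assert (B := HW y N).
apply Rabs_le_between in A; apply Rabs_le_between in B; apply Rabs_def2 in HwN.
apply Rabs_def1; lra.
Qed.

Section Picard.
Variables (p : R -> R) (K : R).
Hypothesis p_continuous : forall x, continuous p x.
Hypothesis p_bounded : forall x, Rabs (p x) <= K.

Let L := 2 * K + 1.

(** The integral form of [y'' = p y], [y(0) = 0], [y'(0) = 1]: [picard1 f] is the slope computed
    from [f], and [picard f] its primitive. *)
Definition picard1 (f : R -> R) (x : R) : R := 1 + RInt (fun s => p s * f s) 0 x.
Definition picard (f : R -> R) (x : R) : R := 0 + RInt (picard1 f) 0 x.

Lemma picard1_derive (f : R -> R) (x : R) :
  (forall y, continuous f y) -> is_derive (picard1 f) x (p x * f x).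
Proof.
intros H; apply (is_derive_RInt_continuous (fun s => p s * f s)).
intros y; apply (continuous_mult p f); auto.
Qed.

Lemma picard_derive (f : R -> R) (x : R) :
  (forall y, continuous f y) -> is_derive (picard f) x (picard1 f x).
Proof.
intros H; apply is_derive_RInt_continuous; intros y.
eapply continuous_is_derive, picard1_derive, H.
Qed.

Lemma is_derive_exp_scal (c l x : R) :
  is_derive (fun s => c * exp (l * s)) x (c * l * exp (l * x)).
Proof. auto_derive; [exact I|ring]. Qed.

(* [picard] contracts by 1/2 in the norm [sup |f x| exp (- L x)], because
   [2 K <= L^2]. *)
Lemma picard_contraction (f g : R -> R) (c x : R) :
  (forall y, continuous f y) -> (forall y, continuous g y) -> 0 <= c ->
  (forall s, unit_interval s -> Rabs (f s - g s) <= c * exp (L * s)) ->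
  unit_interval x -> Rabs (picard f x - picard g x) <= c / 2 * exp (L * x).
Proof.
intros Cf Cg Hc H Hx; unfold unit_interval in *.
assert (HK : 0 <= K) by (apply Rle_trans with (2 := p_bounded 0), Rabs_pos).
assert (HL : 1 <= L) by (unfold L; lra).
assert (Hexp : forall s, 0 < exp (L * s)) by (intros; apply exp_pos).
assert (E10 : forall h, picard1 h 0 = 1)
  by (intros h; unfold picard1; rewrite RInt_point; apply Rplus_0_r).
assert (E0 : forall h, picard h 0 = 0)
  by (intros h; unfold picard; rewrite RInt_point; apply Rplus_0_r).
(* Each of the two integrations of [exp (L * s)] gains a factor [1 / L]; the first one also brings
   in the bound [K] of [p]. *)
assert (B1 : forall s, 0 <= s <= x ->
          Rabs (picard1 f s - picard1 g s) <= K * c / L * exp (L * s)).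
  intros s Hs.
  assert (D := derive_dominated (fun t => picard1 f t - picard1 g t)
    (fun t => p t * f t - p t * g t) (fun t => K * c / L * exp (L * t))
    (fun t => K * c / L * L * exp (L * t)) 0 s).
  cbv beta in D; rewrite !E10 in D.
  replace (picard1 f s - picard1 g s - (1 - 1))
    with (picard1 f s - picard1 g s) in D by ring.
  eapply Rle_trans; [apply D|].
  - lra.
  - intros t Ht; apply (is_derive_minus (picard1 f) (picard1 g));
      apply picard1_derive; auto.
  - intros t _; apply is_derive_exp_scal.
  - intros t Ht; rewrite <- Rmult_minus_distr_l, Rabs_mult.
    replace (K * c / L * L * exp (L * t)) with (K * (c * exp (L * t))) by (field; lra).
    apply Rmult_le_compat; auto using Rabs_pos; apply H; lra.
  - assert (0 <= K * c / L * exp (L * 0)).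
      apply Rmult_le_pos; [|apply Rlt_le, Hexp].
      apply Rdiv_le_0_compat; [apply Rmult_le_pos; lra|lra].
    lra.
assert (D := derive_dominated (fun t => picard f t - picard g t)
    (fun t => picard1 f t - picard1 g t) (fun t => K * c / (L * L) * exp (L * t))
    (fun t => K * c / (L * L) * L * exp (L * t)) 0 x).
cbv beta in D; rewrite !E0 in D.
replace (picard f x - picard g x - (0 - 0))
    with (picard f x - picard g x) in D by ring.
assert (HKL : 0 <= K * c / (L * L) <= c / 2).
  split.
    apply Rdiv_le_0_compat; [apply Rmult_le_pos; lra|nra].
  apply Rle_div_l; [nra|].
  assert (2 * K <= L * L) by (unfold L; nra).
  nra.
eapply Rle_trans; [apply D|].
- lra.
- intros t Ht; apply (is_derive_minus (picard f) (picard g));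
    apply picard_derive; auto.
- intros t _; apply is_derive_exp_scal.
- intros t Ht.
  replace (K * c / (L * L) * L * exp (L * t)) with (K * c / L * exp (L * t))
    by (field; lra).
  apply B1; lra.
- assert (Hx0 := Hexp 0); specialize (Hexp x); nra.
Qed.

(** Picard iteration from 0. The weighted contraction halves successive differences on [0,1], and
    [clamp] in the iterates makes the bound uniform on the line. *)
Lemma solution_exists : exists y y1, solution p y y1.
Proof.
set (w := fix w n := match n with
  | O => fun _ : R => 0
  | S m => fun x => picard (w m) (clamp x) end).
assert (Cw : forall n x, continuous (w n) x).
  induction n as [|n IH]; intros x; simpl; [apply continuous_const|].
  apply (continuous_clamp_comp (picard (w n))); intros y _.
  apply continuous_continue_in.
  eapply continuous_is_derive, picard_derive, IH.
assert (HK : 0 <= K) by (apply Rle_trans with (2 := p_bounded 0), Rabs_pos).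
assert (HL : 1 <= L) by (unfold L; lra).
assert (P2 : forall n, 0 < (/ 2) ^ n) by (intros n; apply pow_lt; lra).
assert (B : forall n x, unit_interval x ->
          Rabs (w (S n) x - w n x) <= (/ 2) ^ n * exp (L * x)).
  induction n as [|n IH]; intros x Hx.
    simpl; rewrite clamp_id by exact Hx; unfold picard, unit_interval in *.
    replace (RInt (picard1 (fun _ => 0)) 0 x) with x.
      assert (He : 1 + L * x <= exp (L * x)).
        destruct (Req_dec (L * x) 0) as [->|Hne]; [rewrite exp_0; lra|].
        apply Rlt_le, exp_ineq1; nra.
      rewrite Rabs_pos_eq; nra.
    rewrite (RInt_ext _ (fun _ => 1)).
      rewrite (RInt_const (V := R_CompleteNormedModule)); unfold scal; simpl;
      unfold mult; simpl; ring.
    intros s _; unfold picard1.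
    rewrite (RInt_ext _ (fun _ => 0)) by (intros; simpl; ring).
    rewrite (RInt_const (V := R_CompleteNormedModule)); unfold scal; simpl;
      unfold mult; simpl; ring.
  change (Rabs (picard (w (S n)) (clamp x) - picard (w n) (clamp x))
            <= (/ 2) ^ S n * exp (L * x)).
  rewrite clamp_id by exact Hx.
  replace ((/ 2) ^ S n) with ((/ 2) ^ n / 2) by (simpl; field).
  apply picard_contraction; auto; apply Rlt_le, P2.
assert (wc : forall n x, w n x = w n (clamp x)).
  destruct n; intros x; simpl; [reflexivity|].
  rewrite (clamp_id (clamp x)) by apply clamp_unit; reflexivity.
destruct (geometric_uniform_limit w (exp L) Cw) as [W [CW HW]].
  intros n x; rewrite (wc (S n) x), (wc n x).
  apply Rle_trans with (1 := B n _ (clamp_unit x)).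
  assert (Hc := clamp_unit x); unfold unit_interval in Hc.
  assert (exp (L * clamp x) <= exp L).
    destruct (Req_dec (clamp x) 1) as [->|Hne]; [rewrite Rmult_1_r; lra|].
    apply Rlt_le, exp_increasing; nra.
  specialize (P2 n); nra.
assert (Fix : forall x, unit_interval x -> picard W x = W x).
  intros x Hx.
  (* On [0,1] [picard (w n)] is [w (S n)], and both [picard W] and [W] lie within a multiple of
     [(/ 2) ^ n] of it. *)
  assert (Hn : forall n, Rabs (picard W x - W x) <= 2 * exp L * exp L * (/ 2) ^ n).
    intros n.
    assert (A : Rabs (picard W x - picard (w n) x)
                <= 2 * exp L * (/ 2) ^ n / 2 * exp (L * x)).
      apply picard_contraction; auto.
        assert (H := exp_pos L); specialize (P2 n); nra.
      intros s Hs; apply Rle_trans with (1 := HW n s).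
      assert (1 <= exp (L * s)).
        rewrite <- exp_0; unfold unit_interval in Hs.
        destruct (Req_dec (L * s) 0) as [->|Hne]; [lra|].
        apply Rlt_le, exp_increasing; nra.
      assert (H' := exp_pos L); specialize (P2 n).
      assert (0 < 2 * exp L * (/ 2) ^ n) by (apply Rmult_lt_0_compat; lra).
      nra.
    assert (A' := HW (S n) x); simpl in A'; rewrite (clamp_id x Hx) in A'.
    assert (E1 : exp (L * x) <= exp L).
      unfold unit_interval in Hx.
      destruct (Req_dec x 1) as [->|Hne]; [rewrite Rmult_1_r; lra|].
      apply Rlt_le, exp_increasing; nra.
    assert (E2 : 1 <= exp L)
      by (rewrite <- exp_0; apply Rlt_le, exp_increasing; lra).
    specialize (P2 n).
    replace (picard W x - W x) with
      ((picard W x - picard (w n) x) - (W x - picard (w n) x)) by ring.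
    unfold Rminus at 1; apply Rle_trans with (1 := Rabs_triang _ _).
    rewrite Rabs_Ropp.
    assert (0 < exp L * (/ 2) ^ n) by (apply Rmult_lt_0_compat; lra).
    nra.
  apply Rminus_diag_uniq, Rabs_eq_0, Rle_antisym; [|apply Rabs_pos].
  apply (is_lim_seq_le (fun _ => Rabs (picard W x - W x))
    (fun n => 2 * exp L * exp L * (/ 2) ^ n) (Rabs (picard W x - W x)) 0 Hn).
    apply is_lim_seq_const.
  replace (Finite 0) with (Rbar_mult (2 * exp L * exp L) 0) by (simpl; f_equal; ring).
  apply is_lim_seq_scal_l, is_lim_seq_geom; rewrite Rabs_pos_eq; lra.
(* [picard W] equals [W] on [0,1] and is moreover differentiable on the whole line, whereas [W] is
   frozen outside [0,1]. *)
exists (picard W), (picard1 W).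
split; [unfold picard; rewrite RInt_point; apply Rplus_0_r|].
split; [unfold picard1; rewrite RInt_point; apply Rplus_0_r|].
split; [intros x; apply picard_derive, CW|].
intros x Hx; rewrite Fix by exact Hx; apply picard1_derive, CW.
Qed.
End Picard.

(** * Uniqueness and dependence on the parameter *)

(* Multiplying the energy [d^2 + d1^2 + r^2] by [exp (- (K+2) x)] makes it
   nonincreasing. *)
Lemma energy_bound (d d1 d2 : R -> R) (K r : R) :
  0 <= K -> d 0 = 0 -> d1 0 = 0 ->
  (forall x, unit_interval x -> is_derive d x (d1 x)) ->
  (forall x, unit_interval x -> is_derive d1 x (d2 x)) ->
  (forall x, unit_interval x -> Rabs (d2 x) <= K * Rabs (d x) + r) ->
  forall x, unit_interval x -> d x ^ 2 + d1 x ^ 2 <= r ^ 2 * exp (K + 2).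
Proof.
intros HK H0 H1 Hd Hd1 Hd2 x Hx.
set (F := fun s => - ((d s ^ 2 + d1 s ^ 2 + r ^ 2) * exp (- (K + 2) * s))).
set (F1 := fun s => ((K + 2) * (d s ^ 2 + d1 s ^ 2 + r ^ 2)
                    - 2 * d s * d1 s - 2 * d1 s * d2 s) * exp (- (K + 2) * s)).
unfold unit_interval in *.
assert (HF : F 0 <= F x).
  apply (derive_nonneg_le F F1); [lra| |].
    intros s Hs; unfold F, F1.
    assert (A := Hd s); assert (B := Hd1 s).
    auto_derive.
      repeat split; try exact I; [exists (d1 s); apply A|exists (d2 s); apply B]; lra.
    assert (A' : Derive (fun t : R => d t) s = d1 s) by (apply is_derive_unique, A; lra).
    assert (B' : Derive (fun t : R => d1 t) s = d2 s) by (apply is_derive_unique, B; lra).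
    rewrite A', B'; ring.
  intros s Hs; unfold F1; apply Rmult_le_pos; [|apply Rlt_le, exp_pos].
  assert (A := Hd2 s ltac:(lra)).
  assert (Hr : 2 * (d1 s * d2 s) <= 2 * (Rabs (d1 s) * (K * Rabs (d s) + r))).
    apply Rmult_le_compat_l; [lra|]; apply Rle_trans with (1 := Rle_abs _).
    rewrite Rabs_mult; apply Rmult_le_compat_l; [apply Rabs_pos|exact A].
  assert (Ed := pow2_abs (d s)); assert (Ed1 := pow2_abs (d1 s)).
  (* Three squares bound [2 d d1], [2 K |d| |d1|] and [2 r |d1|]; together they use at most [K + 2]
     times each of [d^2], [d1^2] and [r^2]. *)
  assert (Hc : 0 <= K * (Rabs (d s) - Rabs (d1 s)) ^ 2)
    by (apply Rmult_le_pos; [lra|apply pow2_ge_0]).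
  assert (Hb := pow2_ge_0 (Rabs (d1 s) - r)).
  assert (Ha := pow2_ge_0 (d s - d1 s)).
  assert (0 <= (K + 1) * r ^ 2)
    by (apply Rmult_le_pos; [lra|apply pow2_ge_0]).
  assert (H3 := pow2_ge_0 (d s)).
  nra.
unfold F in HF; rewrite H0, H1, Rmult_0_r, exp_0 in HF.
assert (He : exp (- (K + 2) * x) * exp ((K + 2) * x) = 1)
  by (rewrite <- exp_plus, <- exp_0; f_equal; ring).
assert (He1 : exp ((K + 2) * x) <= exp (K + 2)).
  destruct (Req_dec x 1) as [->|Hne]; [rewrite Rmult_1_r; lra|].
  apply Rlt_le, exp_increasing; nra.
assert (Hp := exp_pos ((K + 2) * x)); assert (Hr := pow2_ge_0 r).
assert (HE : d x ^ 2 + d1 x ^ 2 + r ^ 2 <= r ^ 2 * exp ((K + 2) * x)).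
  set (E := d x ^ 2 + d1 x ^ 2 + r ^ 2) in *.
  replace E with (E * (exp (- (K + 2) * x) * exp ((K + 2) * x))) by (rewrite He; ring).
  nra.
nra.
Qed.

Lemma sq_sum_le (a b c : R) : 0 <= c -> a ^ 2 + b ^ 2 <= c ^ 2 -> Rabs a <= c /\ Rabs b <= c.
Proof.
intros Hc H; assert (A := pow2_ge_0 a); assert (B := pow2_ge_0 b).
split;
  rewrite <- (Rabs_pos_eq c Hc); apply Rsqr_le_abs_0; unfold Rsqr; nra.
Qed.

Lemma solution_unique (p y y1 : R -> R) (K : R) :
  (forall x, unit_interval x -> Rabs (p x) <= K) ->
  (forall x, unit_interval x -> is_derive y x (y1 x)) ->
  (forall x, unit_interval x -> is_derive y1 x (p x * y x)) ->
  y 0 = 0 -> y1 0 = 0 -> forall x, unit_interval x -> y x = 0 /\ y1 x = 0.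
Proof.
intros HK Hy Hy1 H0 H1 x Hx.
assert (H01 : unit_interval 0) by (unfold unit_interval; lra).
assert (H := energy_bound y y1 (fun x => p x * y x) K 0).
assert (HE : y x ^ 2 + y1 x ^ 2 <= 0 ^ 2).
  replace (0 ^ 2) with (0 ^ 2 * exp (K + 2)) by ring.
  apply H; auto.
    apply Rle_trans with (1 := Rabs_pos (p 0)); auto.
  intros s Hs; rewrite Rabs_mult, Rplus_0_r.
  apply Rmult_le_compat_r; [apply Rabs_pos|auto].
destruct (sq_sum_le (y x) (y1 x) 0 (Rle_refl 0) HE) as [A B].
split; apply Rabs_eq_0, Rle_antisym; auto using Rabs_pos.
Qed.

(** [y - x] has zero initial data and solves [d'' = p d + p x], so the energy bound applies with
    [r = K]. *)
Lemma solution_bound (p y y1 : R -> R) (K : R) :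
  (forall x, unit_interval x -> Rabs (p x) <= K) -> solution p y y1 ->
  forall x, unit_interval x -> Rabs (y x) <= 1 + K * exp (K + 2).
Proof.
intros HK [H0 [H1 [Hy Hy1]]] x Hx.
assert (K0 : 0 <= K).
  apply Rle_trans with (1 := Rabs_pos (p 0)), HK; unfold unit_interval; lra.
assert (HE := energy_bound (fun s => y s - s) (fun s => y1 s - 1)
  (fun s => p s * y s) K K K0).
cbv beta in HE.
assert (He : 1 <= exp (K + 2))
  by (rewrite <- exp_0; apply Rlt_le, exp_increasing; lra).
destruct (sq_sum_le (y x - x) (y1 x - 1) (K * exp (K + 2))) as [A _].
  apply Rmult_le_pos; lra.
  apply Rle_trans with (K ^ 2 * exp (K + 2)).
    apply HE; auto; try (rewrite ?H0, ?H1; ring).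
    intros s Hs; apply (is_derive_minus y (fun t => t)); [apply Hy|apply @is_derive_id].
    intros s Hs.
      replace (p s * y s) with (p s * y s - 0) by ring.
      apply (is_derive_minus y1 (fun _ => 1)); [auto|apply @is_derive_const].
    intros s Hs; rewrite Rabs_mult.
    replace (y s) with ((y s - s) + s) at 1 by ring.
    assert (T := Rabs_triang (y s - s) s); unfold unit_interval in Hs.
    rewrite (Rabs_pos_eq s) in T by lra.
    assert (Hp := HK s Hs); assert (Q := Rabs_pos (p s)).
    assert (Q' := Rabs_pos (y s - s)); assert (Q'' := Rabs_pos (y s - s + s)).
    nra.
  assert (0 <= K ^ 2) by apply pow2_ge_0.
  rewrite Rpow_mult_distr; nra.
unfold unit_interval in Hx; apply Rabs_le_between in A.
apply Rabs_le; lra.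
Qed.

(** [z - y] solves the equation of [y] with the source [- (l - m) z], and [z] is bounded uniformly
    in [l]. The factor [x], from integrating the bound on the slopes, allows comparison with
    functions vanishing at 0. *)
Lemma solution_perturbation (q : R -> R) (K m : R) :
  (forall x, unit_interval x -> Rabs (q x) <= K) ->
  exists C, 0 <= C /\ forall l y y1 z z1, Rabs (l - m) <= 1 ->
    solution (fun x => q x - m) y y1 -> solution (fun x => q x - l) z z1 ->
    forall x, unit_interval x -> Rabs (z x - y x) <= C * Rabs (l - m) * x.
Proof.
intros HK.
set (K' := K + Rabs m); set (B := 1 + K' * exp (K' + 2)).
assert (K0 : 0 <= K).
  apply Rle_trans with (1 := Rabs_pos (q 0)), HK; unfold unit_interval; lra.
assert (Hm := Rabs_pos m).
set (K2 := K' + 1); set (B2 := 1 + K2 * exp (K2 + 2)).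
assert (HB2 : 0 <= B2).
  unfold B2, K2, K'; assert (H := exp_pos (K + Rabs m + 1 + 2)).
  assert (0 <= (K + Rabs m + 1) * exp (K + Rabs m + 1 + 2)) by (apply Rmult_le_pos; lra).
  lra.
exists (B2 * exp (K' + 2)).
split; [apply Rmult_le_pos; [exact HB2|apply Rlt_le, exp_pos]|].
intros l y y1 z z1 Hl Sy Sz x Hx.
assert (Hzb : forall s, unit_interval s -> Rabs (z s) <= B2).
  apply (solution_bound (fun x => q x - l) z z1 K2); [|exact Sz].
  intros s Hs; unfold K2, K'; specialize (HK s Hs).
  assert (Hlm := Rabs_triang (l - m) m).
  replace (l - m + m) with l in Hlm by ring.
  unfold Rminus; apply Rle_trans with (1 := Rabs_triang _ _); rewrite Rabs_Ropp; lra.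
destruct Sy as [Y0 [Y1 [Hy Hy1]]]; destruct Sz as [Z0 [Z1 [Hz Hz1]]].
assert (Hlm := Rabs_pos (l - m)).
assert (D1 : forall s, unit_interval s ->
  Rabs (z1 s - y1 s) <= B2 * exp (K' + 2) * Rabs (l - m)).
  intros s Hs.
  assert (He : 1 <= exp (K' + 2))
    by (rewrite <- exp_0; apply Rlt_le, exp_increasing; unfold K'; lra).
  apply (sq_sum_le (z s - y s)).
    repeat apply Rmult_le_pos; lra.
  apply Rle_trans with ((B2 * Rabs (l - m)) ^ 2 * exp (K' + 2)).
    apply (energy_bound (fun s => z s - y s) (fun s => z1 s - y1 s)
      (fun s => (q s - l) * z s - (q s - m) * y s) K'); auto.
    - unfold K'; lra.
    - rewrite Z0, Y0; ring.
    - rewrite Z1, Y1; ring.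
    - intros t _; apply (is_derive_minus z y); auto.
    - intros t Ht; apply (is_derive_minus z1 y1); auto.
    - intros t Ht.
      replace ((q t - l) * z t - (q t - m) * y t)
        with ((q t - m) * (z t - y t) + - ((l - m) * z t)) by ring.
      apply Rle_trans with (1 := Rabs_triang _ _).
      rewrite Rabs_Ropp, !Rabs_mult; apply Rplus_le_compat.
        apply Rmult_le_compat_r; [apply Rabs_pos|].
        unfold Rminus; apply Rle_trans with (1 := Rabs_triang _ _).
        rewrite Rabs_Ropp; unfold K'; specialize (HK t Ht); lra.
      rewrite (Rmult_comm B2); apply Rmult_le_compat_l; auto.
  assert (0 <= (B2 * Rabs (l - m)) ^ 2) by apply pow2_ge_0.
  replace ((B2 * exp (K' + 2) * Rabs (l - m)) ^ 2)
    with ((B2 * Rabs (l - m)) ^ 2 * exp (K' + 2) ^ 2) by ring.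
  nra.
unfold unit_interval in Hx.
set (C := B2 * exp (K' + 2) * Rabs (l - m)) in *.
assert (D := derive_dominated (fun t => z t - y t) (fun t => z1 t - y1 t)
    (fun t => C * t) (fun t => C) 0 x).
cbv beta in D; rewrite Z0, Y0 in D.
replace (z x - y x) with (z x - y x - (0 - 0)) by ring.
replace (C * x) with (C * x - C * 0) by ring.
apply D.
- lra.
- intros t _; apply (is_derive_minus z y); auto.
- intros t _; auto_derive; [exact I|ring].
- intros t Ht; apply D1; unfold unit_interval; lra.
Qed.

(** * Positive eigenfunctions *)

(* The Wronskian [u1 w - u w1] vanishes at 0 and has derivative [(p - r) u w]. *)
Lemma sturm_wronskian (p r u u1 w w1 : R -> R) (x0 : R) :
  solution p u u1 -> solution r w w1 -> 0 < x0 <= 1 ->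
  (forall x, 0 < x < x0 -> 0 < u x /\ 0 < w x /\ r x < p x) ->
  0 < u1 x0 * w x0 - u x0 * w1 x0.
Proof.
intros [U0 [_ [Hu Hu1]]] [W0 [_ [Hw Hw1]]] Hx0 H.
assert (D := derive_pos_lt (fun x => u1 x * w x - u x * w1 x)
  (fun x => (p x - r x) * (u x * w x)) 0 x0).
cbv beta in D; rewrite U0, W0, Rmult_0_r, Rmult_0_l, Rminus_diag in D.
apply D; [lra| |].
  intros x Hx; assert (Ix : unit_interval x) by (unfold unit_interval; lra).
  replace ((p x - r x) * (u x * w x)) with
    ((p x * u x * w x + u1 x * w1 x) - (u1 x * w1 x + u x * (r x * w x))) by ring.
  apply (is_derive_minus (fun x => u1 x * w x) (fun x => u x * w1 x)).
    apply (is_derive_mult u1 w); auto; intros; apply Rmult_comm.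
  apply (is_derive_mult u w1); auto; intros; apply Rmult_comm.
intros x Hx; destruct (H x Hx) as [A [B C]].
repeat apply Rmult_lt_0_compat; lra.
Qed.

(** [c] is the supremum of the points up to which [f] stays positive. By continuity, [f c > 0] would
    allow going further, and [f c < 0] would contradict positivity to the left of [c]. *)
Lemma first_zero (f : R -> R) (a b : R) :
  (forall x, continuous f x) -> a < b -> 0 < f a -> f b <= 0 ->
  exists c, a < c <= b /\ f c = 0 /\ forall x, a <= x < c -> 0 < f x.
Proof.
intros Cf Hab Ha Hb.
assert (Near : forall x e, 0 < e -> exists d, 0 < d /\
          forall y, Rabs (y - x) < d -> Rabs (f y - f x) < e).
  intros x e He; destruct (proj2 (continuity_pt_filterlim _ _) (Cf x) e He)
    as [d [Hd H]].
  exists d; split; [exact Hd|]; intros y Hy.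
  destruct (Req_dec x y) as [<-|Hne]; [rewrite Rminus_diag, Rabs_R0; lra|].
  apply H; split; [split; [exact I|exact Hne]|exact Hy].
set (E := fun x => a <= x <= b /\ forall t, a <= t <= x -> 0 < f t).
assert (Ea : E a).
  split; [lra|]; intros t Ht; replace t with a by lra; exact Ha.
destruct (completeness E) as [c [Hub Hlub]].
  exists b; intros x [Hx _]; lra.
  exists a; exact Ea.
assert (Hac : a <= c) by (apply Hub, Ea).
assert (Hcb : c <= b) by (apply Hlub; intros x [Hx _]; lra).
assert (Hpos : forall x, a <= x < c -> 0 < f x).
  intros x Hx; destruct (classic (exists e, E e /\ x < e)) as [[e [[_ He] Hxe]]|N].
    apply He; lra.
  exfalso; assert (c <= x); [|lra].
  apply Hlub; intros e He; apply Rnot_lt_le; intros Hxe; apply N.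
  exists e; auto.
assert (Hfc : f c <= 0).
  apply Rnot_lt_le; intros Hfc.
  assert (Hcb' : c < b) by (destruct Hcb as [|E1]; [assumption|rewrite E1 in Hfc; lra]).
  destruct (Near c (f c) Hfc) as [d [Hd H]].
  set (e := Rmin (d / 2) (b - c)).
  assert (H1 := Rmin_l (d / 2) (b - c)); assert (H2 := Rmin_r (d / 2) (b - c)).
  fold e in H1, H2; assert (He : 0 < e) by (apply Rmin_glb_lt; lra).
  assert (c + e <= c); [|lra].
  apply Hub; split; [lra|]; intros t Ht.
  destruct (Rlt_le_dec t c) as [Htc|Htc]; [apply Hpos; lra|].
  assert (Q := H t); apply Rabs_def2 in Q; [lra|].
  rewrite Rabs_pos_eq; lra.
assert (Hac' : a < c) by (destruct Hac as [|E1]; [assumption|rewrite E1 in Ha; lra]).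
exists c; split; [lra|]; split; [|exact Hpos].
apply Rle_antisym; [exact Hfc|]; apply Rnot_lt_le; intros Hneg.
destruct (Near c (- f c)) as [d [Hd H]]; [lra|].
set (e := Rmin (d / 2) (c - a)).
assert (H1 := Rmin_l (d / 2) (c - a)); assert (H2 := Rmin_r (d / 2) (c - a)).
fold e in H1, H2; assert (He : 0 < e) by (apply Rmin_glb_lt; lra).
assert (Q := H (c - e)).
replace (c - e - c) with (- e) in Q by ring.
rewrite Rabs_Ropp, Rabs_pos_eq in Q by lra.
assert (Q' := Rabs_def2 _ _ (Q ltac:(lra))).
assert (0 < f (c - e)) by (apply Hpos; lra); lra.
Qed.

Lemma derive_pos_left (f : R -> R) (x l : R) :
  is_derive f x l -> 0 < l ->
  exists d, 0 < d /\ forall h, 0 < h < d -> f (x - h) < f x /\ f x < f (x + h).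
Proof.
intros H Hl; apply is_derive_Reals in H.
destruct (H l Hl) as [d Hd]; exists d; split; [apply cond_pos|].
assert (Q : forall k, k <> 0 -> Rabs k < d -> 0 < (f (x + k) - f x) / k).
  intros k Hk Hkd; specialize (Hd k Hk Hkd); apply Rabs_def2 in Hd; lra.
intros h Hh; split.
  assert (A := Q (- h)).
  rewrite Rabs_Ropp, Rabs_pos_eq in A by lra.
  specialize (A ltac:(lra) ltac:(lra)).
  replace ((f (x + - h) - f x) / - h) with ((f x - f (x - h)) / h) in A
    by (unfold Rminus; field; lra).
  apply Rlt_div_r in A; lra.
assert (A := Q h); rewrite Rabs_pos_eq in A by lra.
specialize (A ltac:(lra) ltac:(lra)); apply Rlt_div_r in A; lra.
Qed.

(** By continuity the slope stays above 1/2 near 0. This gives positivity close to 0, where [y]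
    itself vanishes. *)
Lemma solution_near_zero (p y y1 : R -> R) :
  solution p y y1 ->
  exists d, 0 < d <= 1 /\ forall x, 0 <= x <= d -> x / 2 <= y x.
Proof.
intros [H0 [H1 [Hy Hy1]]].
assert (C : continuous y1 0)
  by (eapply continuous_is_derive, Hy1; unfold unit_interval; lra).
apply continuity_pt_filterlim in C.
destruct (C (1 / 2)) as [d [Hd H]]; [lra|].
exists (Rmin (d / 2) 1).
assert (A := Rmin_l (d / 2) 1); assert (B := Rmin_r (d / 2) 1).
split; [split; [apply Rmin_glb_lt; lra|exact B]|]; intros x Hx.
assert (D := derive_nonneg_le (fun t => y t - t / 2) (fun t => y1 t - / 2) 0 x).
cbv beta in D; rewrite H0 in D.
assert (0 - 0 / 2 <= y x - x / 2); [|lra].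
apply D; [lra| |].
  intros t _; apply (is_derive_minus y (fun t => t / 2)); [apply Hy|].
  auto_derive; [exact I|field].
intros t Ht.
assert (Q : Rabs (y1 t - y1 0) < 1 / 2).
  apply H; split; [split; [exact I|lra]|]; simpl; unfold R_dist.
  rewrite Rminus_0_r, Rabs_pos_eq; lra.
rewrite H1 in Q; apply Rabs_def2 in Q; lra.
Qed.

(** Sturm comparison. At the first zero [c] of [y] the Wronskian is [y'(c) w(c)] and positive, so
    [y'(c) > 0]; but [y] comes down to 0 from positive values. *)
Lemma sturm_positive (p r y y1 w w1 : R -> R) :
  solution p y y1 -> solution r w w1 ->
  (forall x, 0 < x < 1 -> 0 < w x /\ r x < p x) -> 0 <= w 1 ->
  forall x, 0 < x <= 1 -> 0 < y x.
Proof.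
intros Sy Sw H Hw1 x Hx; apply Rnot_le_lt; intros Hyx.
destruct (solution_near_zero p y y1 Sy) as [d [Hd Nd]].
assert (Hdx : d < x).
  apply Rnot_le_lt; intros Hxd; specialize (Nd x ltac:(lra)); lra.
assert (Sy' := Sy); destruct Sy' as [_ [_ [Hy _]]].
destruct (first_zero y d x) as [c [Hc [Yc Pc]]]; auto.
  intros t; eapply continuous_is_derive, Hy.
  specialize (Nd d ltac:(lra)); lra.
assert (W := sturm_wronskian p r y y1 w w1 c Sy Sw ltac:(lra)).
rewrite Yc, Rmult_0_l, Rminus_0_r in W.
assert (Pos : 0 < y1 c * w c).
  apply W; intros t Ht.
  destruct (H t) as [A B]; [lra|]; repeat split; auto.
  destruct (Rle_lt_dec d t); [apply Pc; lra|].
  specialize (Nd t ltac:(lra)); lra.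
assert (Hwc : 0 <= w c).
  destruct (proj2 Hc) as [Hcx|Ecx].
    apply Rlt_le, H; lra.
  destruct (Req_dec c 1) as [->|]; [exact Hw1|apply Rlt_le, H; lra].
assert (Y1c : 0 < y1 c).
  apply Rnot_le_lt; intros N; nra.
destruct (derive_pos_left y c (y1 c) (Hy c) Y1c) as [e [He Le]].
set (h := Rmin (e / 2) (c - d)).
assert (A := Rmin_l (e / 2) (c - d)); assert (B := Rmin_r (e / 2) (c - d)).
fold h in A, B; assert (Hh : 0 < h) by (apply Rmin_glb_lt; lra).
assert (Q := proj1 (Le h ltac:(lra))).
assert (0 < y (c - h)) by (apply Pc; lra); lra.
Qed.

(** A double zero at [x0] would make [y] vanish on [0, x0] by uniqueness run backwards, against
    [y'(0) = 1]. The substitution [x = x0 (1 - s)] moves the problem to [0,1] and puts the factor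
    [x0 ^ 2] in the potential. *)
Lemma solution_simple_zero (p y y1 : R -> R) (K x0 : R) :
  (forall x, unit_interval x -> Rabs (p x) <= K) -> solution p y y1 ->
  unit_interval x0 -> y x0 = 0 -> y1 x0 <> 0.
Proof.
intros HK [H0 [H1 [Hy Hy1]]] Hx0 Z0 Z1; unfold unit_interval in *.
assert (U := solution_unique (fun s => x0 ^ 2 * p (x0 * (1 - s)))
  (fun s => y (x0 * (1 - s))) (fun s => - x0 * y1 (x0 * (1 - s))) K).
assert (I1 : unit_interval 1) by (unfold unit_interval; lra).
assert (Arg : forall s, unit_interval s -> 0 <= x0 * (1 - s) <= 1)
  by (unfold unit_interval; intros; nra).
destruct (U) with (x := 1) as [_ E]; auto.
- intros s Hs; rewrite Rabs_mult, (Rabs_pos_eq (x0 ^ 2)) by apply pow2_ge_0.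
  specialize (HK _ (Arg s Hs)).
  assert (Q := Rabs_pos (p (x0 * (1 - s)))).
  assert (0 <= x0 ^ 2 <= 1) by nra.
  nra.
- intros s Hs.
  apply (is_derive_comp y (fun t => x0 * (1 - t)) s (y1 (x0 * (1 - s))) (- x0)).
    apply Hy.
  auto_derive; [exact I|ring].
- intros s Hs.
  replace (x0 ^ 2 * p (x0 * (1 - s)) * y (x0 * (1 - s))) with
    (- x0 * (- x0 * (p (x0 * (1 - s)) * y (x0 * (1 - s))))) by ring.
  apply (is_derive_scal (fun t => y1 (x0 * (1 - t)))).
  apply (is_derive_comp y1 (fun t => x0 * (1 - t)) s
           (p (x0 * (1 - s)) * y (x0 * (1 - s))) (- x0)).
    apply Hy1, Arg, Hs.
  auto_derive; [exact I|ring].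
- rewrite Rminus_0_r, Rmult_1_r; exact Z0.
- rewrite Rminus_0_r, Rmult_1_r, Z1; ring.
- rewrite Rminus_diag, Rmult_0_r, H1 in E.
  assert (x0 = 0) by lra; subst x0; lra.
Qed.

Lemma solution_sin : solution (fun _ => - PI ^ 2) (fun x => sin (PI * x) / PI)
  (fun x => cos (PI * x)).
Proof.
assert (HPI := PI_RGT_0).
split; [rewrite Rmult_0_r, sin_0; field; lra|].
split; [rewrite Rmult_0_r, cos_0; reflexivity|].
split; intros x; [|intros _]; auto_derive; try exact I; field; lra.
Qed.

Lemma sin_PI_pos (x : R) : 0 < x < 1 -> 0 < sin (PI * x) / PI.
Proof.
assert (HPI := PI_RGT_0); intros Hx.
apply Rdiv_lt_0_compat; [apply sin_gt_0; nra|exact HPI].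
Qed.

Lemma solution_linear : solution (fun _ => 0) (fun x => x) (fun _ => 1).
Proof.
split; [reflexivity|]; split; [reflexivity|]; split.
  intros x; apply @is_derive_id.
intros x _; rewrite Rmult_0_l; apply @is_derive_const.
Qed.

(** The spectral parameter is absorbed in the potential: for a potential [q] with eigenvalue [l],
    [p x] is [q x - l]. *)
Definition ground_state (p u u1 : R -> R) : Prop :=
  solution p u u1 /\ u 1 = 0 /\ forall x, 0 < x < 1 -> 0 < u x.

(** The Wronskian vanishes at 1 with [u] and [w], whereas strictly ordered potentials would make it
    positive. *)
Lemma ground_state_incomparable (p r u u1 w w1 : R -> R) :
  ground_state p u u1 -> ground_state r w w1 ->
  ~ (forall x, 0 < x < 1 -> r x < p x).
Proof.
intros [Su [U1 Pu]] [Sw [W1 Pw]] H.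
assert (W := sturm_wronskian p r u u1 w w1 1 Su Sw ltac:(lra)).
rewrite U1, W1 in W.
assert (0 < u1 1 * 0 - 0 * w1 1); [|lra].
apply W; auto.
Qed.

Lemma ground_state_sin : ground_state (fun _ => - PI ^ 2)
  (fun x => sin (PI * x) / PI) (fun x => cos (PI * x)).
Proof.
assert (HPI := PI_RGT_0).
split; [apply solution_sin|]; split; [|apply sin_PI_pos].
rewrite Rmult_1_r, sin_PI; field; lra.
Qed.

(* [l] is the supremum of the [m] whose solution is positive on (0,1]. *)
Lemma ground_state_exists (q : R -> R) :
  (forall x, continuous q x) -> (forall x, 0 <= q x <= 1) ->
  exists l u u1, ground_state (fun x => q x - l) u u1.
Proof.
intros Cq Bq.
assert (HPI := PI_RGT_0).
assert (Ex : forall m, exists y y1, solution (fun x => q x - m) y y1).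
  intros m; apply (solution_exists _ (1 + Rabs m)).
    intros x; apply (continuous_minus q (fun _ => m)); [apply Cq|apply continuous_const].
  intros x; unfold Rminus; apply Rle_trans with (1 := Rabs_triang _ _).
  rewrite Rabs_Ropp, Rabs_pos_eq by apply Bq; apply Rplus_le_compat_r, Bq.
set (S := fun m => exists y y1, solution (fun x => q x - m) y y1 /\
                     forall x, 0 < x <= 1 -> 0 < y x).
destruct (completeness S) as [l [Hub Hlub]].
(* For larger [m] the potential [q - m] is below [- PI ^ 2], so the Wronskian of the sine and [y]
   would be positive at 1, where it equals [- y 1]. *)
- exists (PI ^ 2 + 1); intros m [y [y1 [Sy Py]]].
  apply Rnot_lt_le; intros Hm.
  assert (W := sturm_wronskian (fun _ => - PI ^ 2) (fun x => q x - m)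
    _ _ y y1 1 solution_sin Sy ltac:(lra)).
  cbv beta in W; rewrite Rmult_1_r, sin_PI, cos_PI in W.
  assert (0 < y 1) by (apply Py; lra).
  assert (0 < -1 * y 1 - 0 / PI * y1 1).
    apply W; intros x Hx; split; [apply sin_PI_pos; lra|].
    split; [apply Py; lra|specialize (Bq x); lra].
  unfold Rdiv in *; lra.
(* The potential [q + 1] is positive, and the solution of [y'' = 0] serves as comparison
   function. *)
- exists (-1); destruct (Ex (-1)) as [y [y1 Sy]]; exists y, y1; split; [exact Sy|].
  apply (sturm_positive _ _ y y1 _ _ Sy solution_linear); [|lra].
  intros x Hx; split; [lra|specialize (Bq x); lra].
- destruct (Ex l) as [y [y1 Sy]]; exists l, y, y1.
  destruct (solution_perturbation q 1 l) as [C [HC Pert]].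
    intros x _; rewrite Rabs_pos_eq; apply Bq.
  (* A negative value of [y] would persist for all parameters within [e] of [l], while [S] has
     elements there. *)
  assert (Hyge : forall x, 0 < x <= 1 -> 0 <= y x).
    intros x Hx; apply Rnot_lt_le; intros Hneg.
    set (e := Rmin 1 (- y x / (C + 1))).
    assert (E1 := Rmin_l 1 (- y x / (C + 1))); assert (E2 := Rmin_r 1 (- y x / (C + 1))).
    assert (He : 0 < e) by (apply Rmin_glb_lt; [lra|apply Rdiv_lt_0_compat; lra]).
    fold e in E1, E2.
    destruct (classic (exists m, S m /\ l - e < m)) as [[m [Sm Hm]]|N].
      assert (Hml := Hub m Sm); destruct Sm as [z [z1 [Sz Pz]]].
      assert (Hlm : Rabs (m - l) < e) by (apply Rabs_def1; lra).
      assert (Q := Pert m y y1 z z1 ltac:(lra) Sy Sz x ltac:(unfold unit_interval; lra)).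
      specialize (Pz x Hx); apply Rabs_le_between in Q.
      apply Rle_div_r in E2; [|lra].
      assert (Ha := Rabs_pos (m - l)).
      assert (C * Rabs (m - l) * x <= C * e).
        rewrite Rmult_assoc; apply Rmult_le_compat_l; [exact HC|nra].
      lra.
    assert (l <= l - e); [|lra].
    apply Hlub; intros m Sm; apply Rnot_lt_le; intros Hm; apply N; exists m; auto.
  assert (Sy' := Sy); destruct Sy' as [Y0 [Y1 [Hy Hy1]]].
  (* An interior zero would be a minimum of a nonnegative function, hence a double zero. *)
  assert (Hygt : forall x, 0 < x < 1 -> 0 < y x).
    intros x Hx; destruct (Hyge x ltac:(lra)) as [P|Z]; [exact P|exfalso].
    apply (solution_simple_zero (fun x => q x - l) y y1 (1 + Rabs l) x); auto.
      intros t _; unfold Rminus; apply Rle_trans with (1 := Rabs_triang _ _).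
      rewrite Rabs_Ropp; specialize (Bq t); rewrite Rabs_pos_eq; lra.
      unfold unit_interval; lra.
    assert (pr : derivable_pt_lim y x (y1 x)) by apply is_derive_Reals, Hy.
    assert (dm := deriv_minimum y 0 1 x (exist _ (y1 x) pr)).
    apply dm; try lra; intros t Ht0 Ht1; rewrite <- Z; apply Hyge; lra.
  split; [exact Sy|]; split; [|exact Hygt].
  (* If [y 1 > 0], then [y x >= c x] on [0,1] for some [c > 0]. The perturbation bound is
     proportional to [x] as well, so a slightly larger parameter would still belong to [S]. *)
  destruct (Hyge 1 ltac:(lra)) as [P|Z]; [exfalso|congruence].
  assert (Hc : exists c, 0 < c /\ forall x, 0 <= x <= 1 -> c * x <= y x).
    destruct (solution_near_zero _ y y1 Sy) as [d [Hd Nd]].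
    destruct (continuity_ab_min y d 1 ltac:(lra)) as [x0 [Hmin Hx0]].
      intros t _; apply continuity_pt_filterlim.
      eapply continuous_is_derive, Hy.
    assert (Px0 : 0 < y x0).
      destruct (Req_dec x0 1) as [->|]; [exact P|apply Hygt; lra].
    exists (Rmin (/ 2) (y x0)).
    assert (A := Rmin_l (/ 2) (y x0)); assert (B := Rmin_r (/ 2) (y x0)).
    assert (0 < Rmin (/ 2) (y x0)) by (apply Rmin_glb_lt; lra).
    split; [assumption|]; intros x Hx.
    destruct (Rle_lt_dec x d).
      specialize (Nd x ltac:(lra)); nra.
    specialize (Hmin x ltac:(lra)); nra.
  destruct Hc as [c [Hc0 Hc]].
  set (e := Rmin 1 (c / (2 * (C + 1)))).
  assert (E1 := Rmin_l 1 (c / (2 * (C + 1)))).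
  assert (E2 := Rmin_r 1 (c / (2 * (C + 1)))).
  assert (He : 0 < e) by (apply Rmin_glb_lt; [lra|apply Rdiv_lt_0_compat; lra]).
  fold e in E1, E2.
  assert (l + e <= l); [|lra].
  apply Hub; destruct (Ex (l + e)) as [z [z1 Sz]]; exists z, z1.
  split; [exact Sz|]; intros x Hx.
  assert (Habs : Rabs (l + e - l) = e)
    by (replace (l + e - l) with e by ring; apply Rabs_pos_eq; lra).
  assert (Q := Pert (l + e) y y1 z z1 ltac:(lra) Sy Sz x ltac:(unfold unit_interval; lra)).
  rewrite Habs in Q; apply Rabs_le_between in Q.
  apply Rle_div_r in E2; [|lra].
  specialize (Hc x ltac:(lra)).
  assert (C * e * x < c * x) by (apply Rmult_lt_compat_r; lra).
  lra.
Qed.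

(** * The smallest eigenvalue *)

Lemma solution_ext (p r u u1 : R -> R) :
  (forall x, unit_interval x -> p x = r x) -> solution p u u1 -> solution r u u1.
Proof.
intros E [H0 [H1 [Hu Hu1]]]; split; [exact H0|]; split; [exact H1|].
split; [exact Hu|]; intros x Hx; rewrite <- E by exact Hx; auto.
Qed.

Lemma classQ_continue_in (q : R -> R) (x : R) :
  classQ q -> unit_interval x -> continue_in q unit_interval x.
Proof.
intros [_ [q1 [q2 [H _]]]] Hx; apply D_in_continue_in with q1, H, Hx.
Qed.

Lemma ground_state_eigenvalue (q u u1 : R -> R) (l : R) :
  classQ q -> ground_state (fun x => q x - l) u u1 -> is_eigenvalue q l.
Proof.
intros Hq [[U0 [_ [Hu Hu1]]] [U1 Pu]].
exists u, u1, (fun x => (q x - l) * u x); split.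
  intros x Hx; split; [apply is_derive_D_in, Hu|].
  split; [apply (is_derive_D_in u1 (fun x => (q x - l) * u x)), Hu1, Hx|].
  unfold continue_in.
  apply limit_mul.
    apply (limit_minus q (fun _ => l)).
      apply classQ_continue_in; assumption.
    apply (limit_free (fun _ => l) _ 0).
  apply (continuous_continue_in u unit_interval x).
  eapply continuous_is_derive, Hu.
split; [intros; ring|]; split; [exact U0|]; split; [exact U1|].
exists (1 / 2); split; [unfold unit_interval; lra|].
specialize (Pu (1 / 2) ltac:(lra)); lra.
Qed.

(** If [m < l], comparison with the ground state makes the shooting solution [y] for [m] positive at
    1. By uniqueness an eigenfunction for [m] is a multiple of [y], so its zero at 1 forces it to
    vanish identically. *)
Lemma ground_state_le_eigenvalue (q u u1 : R -> R) (l m : R) :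
  classQ q -> ground_state (fun x => q x - l) u u1 -> is_eigenvalue q m -> l <= m.
Proof.
intros Hq [Su [U1 Pu]] [v [v1 [v2 [Hv [Ev [V0 [V1 [x0 [Hx0 Nv]]]]]]]]].
apply Rnot_lt_le; intros Hml; apply Nv.
destruct (C2_with_extend v v1 v2 Hv) as [w [w1 [w2 [Dw [Dw1 [Cw2 E]]]]]].
set (g := fun x => q (clamp x) - m).
assert (Cg : forall x, continuous g x).
  intros x; apply (continuous_minus (fun z => q (clamp z)) (fun _ => m)).
    apply continuous_clamp_comp; intros; apply classQ_continue_in; assumption.
  apply continuous_const.
assert (Bg : forall x, Rabs (g x) <= 1 + Rabs m).
  intros x; unfold g, Rminus; apply Rle_trans with (1 := Rabs_triang _ _).
  rewrite Rabs_Ropp; destruct (proj1 Hq (clamp x) (clamp_unit x)).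
  rewrite Rabs_pos_eq; lra.
destruct (solution_exists g _ Cg Bg) as [y [y1 Sy]].
assert (Eq : forall x, unit_interval x -> g x = q x - m)
  by (intros x Hx; unfold g; rewrite clamp_id; auto).
assert (Py : 0 < y 1).
  apply (sturm_positive g (fun x => q x - l) y y1 u u1); auto; try lra.
  intros x Hx; split; [auto|]; rewrite Eq by (unfold unit_interval; lra); lra.
(* The eigenvalue equation is given on the open interval only; continuity of [w2 - g w] carries it
   to the endpoints. *)
assert (Ew2 : forall x, unit_interval x -> w2 x = g x * w x).
  assert (Cd : forall x, continuous (fun x => w2 x - g x * w x) x).
    intros x; apply (continuous_minus w2 (fun x => g x * w x)); [apply Cw2|].
    apply (continuous_mult g w); [apply Cg|eapply continuous_is_derive, Dw].
  assert (Int : forall x, 0 < x < 1 -> w2 x - g x * w x = 0).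
    intros x Hx; assert (Hx' : unit_interval x) by (unfold unit_interval; lra).
    destruct (E x Hx') as [-> [_ ->]]; rewrite Eq by exact Hx'.
    specialize (Ev x Hx); lra.
  intros x Hx; apply Rminus_diag_uniq.
  destruct (Req_dec (w2 x - g x * w x) 0) as [|N]; [assumption|exfalso].
  assert (C := proj2 (continuity_pt_filterlim _ _) (Cd x)).
  destruct (C (Rabs (w2 x - g x * w x)) (Rabs_pos_lt _ N)) as [d [Hd H]].
  unfold unit_interval in Hx.
  assert (Hz : exists z, 0 < z < 1 /\ Rabs (z - x) < d /\ x <> z).
    set (h := Rmin (d / 2) (1 / 4)).
    assert (A := Rmin_l (d / 2) (1 / 4)); assert (B := Rmin_r (d / 2) (1 / 4)).
    assert (Hh : 0 < h) by (apply Rmin_glb_lt; lra); fold h in A, B.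
    destruct (Rle_lt_dec x (1 / 2)); [exists (x + h)|exists (x - h)];
      (split; [lra|split; [apply Rabs_def1; lra|lra]]).
  destruct Hz as [z [Hz [Hzd Hne]]].
  assert (Q := H z (conj (conj I Hne) Hzd)).
  simpl in Q; unfold R_dist in Q; rewrite (Int z Hz) in Q.
  rewrite Rminus_0_l, Rabs_Ropp in Q; lra.
destruct Sy as [Y0 [Y1 [Hy Hy1]]].
assert (I0 : unit_interval 0) by (unfold unit_interval; lra).
assert (I1 : unit_interval 1) by (unfold unit_interval; lra).
assert (U : forall x, unit_interval x -> w x - w1 0 * y x = 0 /\ w1 x - w1 0 * y1 x = 0).
  apply (solution_unique g (fun x => w x - w1 0 * y x)
    (fun x => w1 x - w1 0 * y1 x) (1 + Rabs m)); auto.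
  - intros x _; apply (is_derive_minus w (fun x => w1 0 * y x)); [apply Dw|].
    apply (is_derive_scal y), Hy.
  - intros x Hx.
    replace (g x * (w x - w1 0 * y x)) with (g x * w x - w1 0 * (g x * y x)) by ring.
    apply (is_derive_minus w1 (fun x => w1 0 * y1 x)).
      rewrite <- Ew2 by exact Hx; apply Dw1.
    apply (is_derive_scal y1), Hy1, Hx.
  - rewrite (proj1 (E 0 I0)), V0, Y0; ring.
  - rewrite Y1; ring.
assert (Z : w1 0 = 0).
  assert (A := proj1 (U 1 I1)); rewrite (proj1 (E 1 I1)), V1 in A; nra.
assert (A := proj1 (U x0 Hx0)); rewrite Z, (proj1 (E x0 Hx0)) in A; lra.
Qed.

(** Connects the value chosen by [epsilon] with the shooting construction: a smallest eigenvalue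
    exists, and two of them coincide. All later facts about [lambda] rest on this positive
    eigenfunction. *)
Lemma lambda_ground_state (q : R -> R) :
  classQ q -> exists u u1, ground_state (fun x => q x - lambda q) u u1.
Proof.
intros Hq.
destruct (ground_state_exists (fun x => q (clamp x))) as [l [u [u1 [Su G]]]].
  intros x; apply continuous_clamp_comp; intros; apply classQ_continue_in; assumption.
  intros x; apply (proj1 Hq), clamp_unit.
assert (G' : ground_state (fun x => q x - l) u u1).
  split; [|exact G].
  apply (solution_ext (fun x => q (clamp x) - l)); [|exact Su].
  intros x Hx; rewrite clamp_id; auto.
assert (Sl : is_smallest_eigenvalue q l).
  split; [exact (ground_state_eigenvalue q u u1 l Hq G')|].
  intros m; apply (ground_state_le_eigenvalue q u u1 l m Hq G').
assert (Sl' := epsilon_spec (inhabits 0) (is_smallest_eigenvalue q) (ex_intro _ l Sl)).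
fold (lambda q) in Sl'.
assert (E : lambda q = l) by (apply Rle_antisym; [apply Sl', Sl|apply Sl, Sl']).
rewrite E; exists u, u1; exact G'.
Qed.

(** Otherwise [q - lambda q] would lie strictly below [r - lambda r] on (0,1), which their ground
    states forbid. *)
Lemma lambda_le (q r : R -> R) (d : R) :
  classQ q -> classQ r -> (forall x, unit_interval x -> q x <= r x + d) ->
  lambda q <= lambda r + d.
Proof.
intros Hq Hr H; apply Rnot_lt_le; intros N.
destruct (lambda_ground_state q Hq) as [u [u1 Gu]].
destruct (lambda_ground_state r Hr) as [w [w1 Gw]].
apply (ground_state_incomparable _ _ _ _ _ _ Gw Gu).
intros x Hx; specialize (H x ltac:(unfold unit_interval; lra)); lra.
Qed.

Lemma lambda_lipschitz (q r : R -> R) (d : R) :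
  classQ q -> classQ r -> (forall x, unit_interval x -> Rabs (q x - r x) <= d) ->
  Rabs (lambda q - lambda r) <= d.
Proof.
intros Hq Hr H.
assert (A : lambda q <= lambda r + d).
  apply lambda_le; auto; intros x Hx; specialize (H x Hx).
  apply Rabs_le_between in H; lra.
assert (B : lambda r <= lambda q + d).
  apply lambda_le; auto; intros x Hx; specialize (H x Hx).
  apply Rabs_le_between in H; lra.
apply Rabs_le; lra.
Qed.

Lemma lambda_ge_PI2 (q : R -> R) : classQ q -> PI ^ 2 <= lambda q.
Proof.
intros Hq; apply Rnot_lt_le; intros N.
destruct (lambda_ground_state q Hq) as [u [u1 Gu]].
apply (ground_state_incomparable _ _ _ _ _ _ Gu ground_state_sin).
intros x Hx; destruct (proj1 Hq x); unfold unit_interval; lra.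
Qed.

(** The mean slopes on the two sides of [x] are ordered because [f1] is nonincreasing. The form
    without division covers [a = b]. *)
Lemma concave_chord (f f1 f2 : R -> R) (a b x : R) :
  (forall y, a <= y <= b -> is_derive f y (f1 y)) ->
  (forall y, a <= y <= b -> is_derive f1 y (f2 y)) ->
  (forall y, a < y < b -> f2 y <= 0) -> a <= x <= b ->
  (b - x) * f a + (x - a) * f b <= (b - a) * f x.
Proof.
intros H H1 H2 Hx.
destruct (Req_dec a x) as [<-|Na]; [lra|].
destruct (Req_dec x b) as [->|Nb]; [lra|].
destruct (mean_value f f1 a x) as [c [Ec Hc]]; [lra|intros; apply H; lra|].
destruct (mean_value f f1 x b) as [d [Ed Hd]]; [lra|intros; apply H; lra|].
assert (D : - f1 c <= - f1 d).
  apply (derive_nonneg_le (fun y => - f1 y) (fun y => - f2 y)); [lra| |].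
    intros y Hy; apply (is_derive_opp f1), H1; lra.
  intros y Hy; specialize (H2 y ltac:(lra)); lra.
assert (0 <= (f1 c - f1 d) * ((x - a) * (b - x))).
  apply Rmult_le_pos; [lra|apply Rmult_le_pos; lra].
nra.
Qed.

(** * Upper bounds *)

Lemma classQ_zero : classQ (fun _ => 0).
Proof.
split; [unfold unit_interval; intros; lra|].
exists (fun _ => 0), (fun _ => 0); split.
  intros x _; split; [|split].
  - apply (is_derive_D_in (fun _ => 0) (fun _ => 0)), @is_derive_const.
  - apply (is_derive_D_in (fun _ => 0) (fun _ => 0)), @is_derive_const.
  - apply continuous_continue_in, continuous_const.
intros; rewrite Rabs_R0; lra.
Qed.

(** As second derivatives are bounded by 1, [r - q] plus the parabola [(y - a) (b - y)] is concave,
    so it stays above its chord and hence above [- e]; the parabola is at most [(b - a)^2 / 4]. *)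
Lemma interpolation_error_upper (q r : R -> R) (a b e x : R) :
  classQ q -> classQ r -> 0 <= a -> b <= 1 -> a <= x <= b ->
  q a - r a <= e -> q b - r b <= e -> q x - r x <= e + (b - a) ^ 2 / 4.
Proof.
intros [_ [q1 [q2 [Cq Bq]]]] [_ [r1 [r2 [Cr Br]]]] Ha Hb Hx Qa Qb.
destruct (C2_with_extend q q1 q2 Cq) as [g [g1 [g2 [Dg [Dg1 [_ Eg]]]]]].
destruct (C2_with_extend r r1 r2 Cr) as [k [k1 [k2 [Dk [Dk1 [_ Ek]]]]]].
assert (U : forall y, a <= y <= b -> unit_interval y)
  by (unfold unit_interval; intros; lra).
assert (C := concave_chord (fun y => k y - g y + (y - a) * (b - y))
  (fun y => k1 y - g1 y + (a + b - 2 * y)) (fun y => k2 y - g2 y + (- 2)) a b x).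
cbv beta in C.
rewrite (proj1 (Eg a (U a ltac:(lra)))), (proj1 (Ek a (U a ltac:(lra)))) in C.
rewrite (proj1 (Eg b (U b ltac:(lra)))), (proj1 (Ek b (U b ltac:(lra)))) in C.
rewrite (proj1 (Eg x (U x ltac:(lra)))), (proj1 (Ek x (U x ltac:(lra)))) in C.
destruct (Req_dec a b) as [->|Nab].
  replace x with b by lra; assert (H := pow2_ge_0 (b - b)); lra.
assert (H : (b - a) * (- e) <= (b - a) * (r x - q x + (x - a) * (b - x))).
  eapply Rle_trans; [|apply C]; [nra|intros y Hy|intros y Hy|intros y Hy|exact Hx].
  - apply (is_derive_plus (fun y => k y - g y) (fun y => (y - a) * (b - y))).
      apply (is_derive_minus k g); auto.
    auto_derive; [exact I|ring].
  - apply (is_derive_plus (fun y => k1 y - g1 y) (fun y => a + b - 2 * y)).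
      apply (is_derive_minus k1 g1); auto.
    auto_derive; [exact I|ring].
  - assert (Uy : unit_interval y) by (apply U; lra).
    destruct (Eg y Uy) as [_ [_ ->]]; destruct (Ek y Uy) as [_ [_ ->]].
    destruct (Bq y Uy) as [_ [_ B1]]; destruct (Br y Uy) as [_ [_ B2]].
    apply Rabs_le_between in B1; apply Rabs_le_between in B2; lra.
apply Rmult_le_reg_l in H; [|lra].
assert (S := pow2_ge_0 (x - a - (b - x))); nra.
Qed.

(** [clamp] keeps the point in [0,1] for every index, since an algorithm must name a point of [0,1]
    after any history. *)
Definition node (n i : nat) : R := clamp (INR i / INR n).

Definition nodes (n : nat) : list R := map (node n) (seq 0 (S n)).

Lemma node_eq (n i : nat) : (0 < n)%nat -> (i <= n)%nat -> node n i = INR i / INR n.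
Proof.
intros Hn Hi; apply clamp_id; apply lt_INR in Hn; apply le_INR in Hi; simpl in Hn.
assert (H := pos_INR i).
split; [apply Rdiv_le_0_compat; lra|apply Rle_div_l; lra].
Qed.

Lemma interpolation_error (q r : R -> R) (n : nat) (e : R) :
  classQ q -> classQ r -> (0 < n)%nat ->
  (forall t, In t (nodes n) -> Rabs (q t - r t) <= e) ->
  forall x, unit_interval x -> Rabs (q x - r x) <= e + / (4 * INR n ^ 2).
Proof.
intros Hq Hr Hn He x Hx; unfold unit_interval in Hx.
assert (Hn' := lt_INR 0 n Hn); simpl in Hn'.
assert (In_node : forall i, (i <= n)%nat -> Rabs (q (INR i / INR n) - r (INR i / INR n)) <= e).
  intros i Hi; rewrite <- node_eq by assumption; apply He.
  apply in_map, in_seq; lia.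
destruct (nfloor_ex (x * INR n)) as [i [Hi1 Hi2]]; [apply Rmult_le_pos; lra|].
assert (Hin : (i <= n)%nat) by (apply INR_le; nra).
(* The floor [i] of [n x] equals [n] only at [x = 1], where no cell lies to the right. *)
destruct (Nat.eq_dec i n) as [->|Ne].
  assert (E : x = INR n / INR n) by (replace (INR n / INR n) with 1 by (field; lra); nra).
  rewrite E; assert (A := In_node n (Nat.le_refl n)).
  assert (0 < / (4 * INR n ^ 2)) by (apply Rinv_0_lt_compat; nra); lra.
assert (A := In_node i Hin); assert (B := In_node (S i) ltac:(lia)).
assert (Hi3 : INR (S i) <= INR n) by (apply le_INR; lia).
rewrite S_INR in B, Hi3; assert (Hi0 := pos_INR i).
apply Rabs_le_between in A; apply Rabs_le_between in B.
set (a := INR i / INR n) in *; set (b := (INR i + 1) / INR n) in *.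
assert (Ha : 0 <= a) by (apply Rdiv_le_0_compat; lra).
assert (Hb : b <= 1) by (apply Rle_div_l; lra).
assert (Hax : a <= x <= b) by (split; [apply Rle_div_l|apply Rle_div_r]; lra).
replace (/ (4 * INR n ^ 2)) with ((b - a) ^ 2 / 4) by (unfold a, b; field; lra).
assert (Q1 := interpolation_error_upper q r a b e x Hq Hr Ha Hb Hax ltac:(lra) ltac:(lra)).
assert (Q2 := interpolation_error_upper r q a b e x Hr Hq Ha Hb Hax ltac:(lra) ltac:(lra)).
apply Rabs_le; lra.
Qed.

Definition consistent (e : R) (ts d : list R) (q : R -> R) : Prop :=
  classQ q /\ Forall2 (fun t v => Rabs (q t - v) <= e) ts d.

(** Data compatible with no potential give an arbitrary value; data within [e] of the samples of an
    element of [Q] are always compatible. *)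
Definition consistent_value (e : R) (ts d : list R) : R :=
  lambda (epsilon (inhabits (fun _ => 0)) (consistent e ts d)).

Lemma Forall2_close (q r : R -> R) (e : R) (ts d : list R) :
  Forall2 (fun t v => Rabs (q t - v) <= e) ts d ->
  Forall2 (fun t v => Rabs (r t - v) <= e) ts d ->
  forall t, In t ts -> Rabs (q t - r t) <= 2 * e.
Proof.
intros H; induction H as [|t v ts d Ht _ IH]; intros H' s Hs; [destruct Hs|].
inversion H' as [|? ? ? ? Ht' H'']; subst; destruct Hs as [<-|Hs]; [|auto].
apply Rabs_le_between in Ht; apply Rabs_le_between in Ht'; apply Rabs_le; lra.
Qed.

(** The true and the chosen potential are both within [e] of the data, hence within [2 e] of each
    other at the nodes. *)
Lemma consistent_value_error (q : R -> R) (e : R) (n : nat) (d : list R) :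
  (0 < n)%nat -> consistent e (nodes n) d q ->
  Rabs (lambda q - consistent_value e (nodes n) d) <= 2 * e + / (4 * INR n ^ 2).
Proof.
intros Hn Hq; unfold consistent_value.
assert (Hr := epsilon_spec (inhabits (fun _ => 0)) (consistent e (nodes n) d)
  (ex_intro _ q Hq)).
set (r := epsilon _ _) in *; destruct Hq as [Hq Dq]; destruct Hr as [Hr Dr].
apply lambda_lipschitz; auto.
apply interpolation_error; auto.
apply Forall2_close with d; assumption.
Qed.

Lemma worst_error_le (phi : (R -> R) -> R -> Prop) (e : R) :
  (forall q v, classQ q -> phi q v -> Rabs (lambda q - v) <= e) ->
  Rbar_le (worst_error phi) e.
Proof.
intros H; apply (proj2 (Lub_Rbar_correct _)).
intros x [q [v [Hq [Hv ->]]]]; simpl; auto.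
Qed.

Lemma worst_error_ge (phi : (R -> R) -> R -> Prop) (e : R) (q : R -> R) (v : R) :
  Rbar_le (worst_error phi) e -> classQ q -> phi q v -> Rabs (lambda q - v) <= e.
Proof.
intros H Hq Hv.
apply (Rbar_le_trans (Rabs (lambda q - v)) (worst_error phi) e); [|exact H].
apply (proj1 (Lub_Rbar_correct _)); exists q, v; auto.
Qed.

(** Nonadaptive: the length of the history is the index of the next node. *)
Definition grid_algorithm (n : nat) (F : list R -> R) : algorithm :=
  Algorithm (fun h => node n (length h)) (fun h => clamp_unit _)
    (fun h => (S n <=? length h)%nat) F.

Lemma history_length (A : algorithm) (q : R -> R) (k : nat) :
  length (history A q k) = k.
Proof.
induction k as [|k IH]; [reflexivity|].
simpl; rewrite length_app, IH; simpl; lia.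
Qed.

Lemma grid_history (n : nat) (F : list R -> R) (q : R -> R) (k : nat) :
  history (grid_algorithm n F) q k = map (fun i => (node n i, q (node n i))) (seq 0 k).
Proof.
induction k as [|k IH]; [reflexivity|].
rewrite seq_S, map_app; simpl; rewrite history_length, IH; reflexivity.
Qed.

Lemma evaluations_unique (A : algorithm) (q : R -> R) (k j : nat) :
  evaluations A q k -> evaluations A q j -> k = j.
Proof.
intros [S1 L1] [S2 L2].
destruct (Nat.lt_trichotomy k j) as [H|[H|H]]; [|exact H|].
  rewrite (L2 k H) in S1; discriminate.
rewrite (L1 j H) in S2; discriminate.
Qed.

Lemma grid_evaluations (n : nat) (F : list R -> R) (q : R -> R) :
  evaluations (grid_algorithm n F) q (S n).
Proof.
split; [|intros k Hk];
  unfold grid_algorithm, stop; rewrite history_length;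
  [apply Nat.leb_le|apply Nat.leb_gt]; lia.
Qed.

Lemma nwor_le (n : nat) (eps : R) :
  (0 < n)%nat -> / (4 * INR n ^ 2) <= eps -> Rbar_le (nwor eps) (INR (S n)).
Proof.
intros Hn Heps; apply (proj1 (Glb_Rbar_correct _)).
set (A := grid_algorithm n (consistent_value 0 (nodes n))).
exists A, (S n); split; [split|split; [|reflexivity]].
- intros q _; exists (S n); split; [lia|apply grid_evaluations].
- exists (fun _ => 0); split; [apply classQ_zero|apply grid_evaluations].
- apply worst_error_le; intros q v Hq [k [Hk ->]].
  replace k with (S n)
    by (apply (evaluations_unique A q); [apply grid_evaluations|exact Hk]).
  unfold A; rewrite grid_history, map_map.
  change (Rabs (lambda q - consistent_value 0 (nodes n)
    (map (fun i => q (node n i)) (seq 0 (S n)))) <= eps).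
  apply Rle_trans with (2 * 0 + / (4 * INR n ^ 2)); [|lra].
  apply consistent_value_error; [exact Hn|]; split; [exact Hq|].
  unfold nodes; generalize (seq 0 (S n)).
  intros l; induction l as [|i l IH]; constructor; [|exact IH].
  simpl; rewrite Rminus_diag, Rabs_R0; lra.
Qed.

(** In continuation style each leaf of the bisection passes its left endpoint to [k] as a constant,
    so that the remaining tree is built with the rounded sample already known. *)
Fixpoint round_program (M : nat) (lo hi : R) (k : R -> program) : program :=
  match M with
  | O => k lo
  | S M' => let mid := (lo + hi) / 2 in
      IfLe (Reg 0) (Cst mid) (round_program M' lo mid k) (round_program M' mid hi k)
  end.

(** [F] is specialized to each rounded sample in turn, so the answer at a leaf is a constant, free
    of charge. Every query overwrites register 0, the only one in use. *)
Fixpoint sampling_program (M : nat) (ts : list R) (F : list R -> R) : program :=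
  match ts with
  | [] => Return (Cst (F []))
  | t :: ts' => Query 0 (Cst t) (round_program M 0 1 (fun v =>
      sampling_program M ts' (fun d => F (v :: d))))
  end.

Lemma round_program_spec (M : nat) (lo hi : R) (k : R -> program) (q : R -> R) (s : memory) :
  lo <= s 0%nat <= hi ->
  exists v, Rabs (s 0%nat - v) <= (hi - lo) * (/ 2) ^ M /\
    exec (round_program M lo hi k) q s =
      Outcome (value (exec (k v) q s)) (queries (exec (k v) q s))
        (M + operations (exec (k v) q s)) /\
    (safe (k v) q s -> safe (round_program M lo hi k) q s).
Proof.
revert lo hi; induction M as [|M IH]; intros lo hi Hs.
  exists lo; split; [rewrite Rabs_pos_eq; simpl; lra|]; split; [|auto].
  simpl; destruct (exec (k lo) q s); reflexivity.
simpl; destruct (Rle_dec (s 0%nat) ((lo + hi) / 2)) as [H|H].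
  destruct (IH lo ((lo + hi) / 2) ltac:(lra)) as [v [E1 [E2 E3]]].
  exists v; split; [|split; [rewrite E2; reflexivity|exact E3]].
  apply Rle_trans with (1 := E1), Req_le; field.
destruct (IH ((lo + hi) / 2) hi ltac:(lra)) as [v [E1 [E2 E3]]].
exists v; split; [|split; [rewrite E2; reflexivity|exact E3]].
apply Rle_trans with (1 := E1), Req_le; field.
Qed.

Lemma sampling_program_spec (M : nat) (ts : list R) (q : R -> R) :
  classQ q -> (forall t, In t ts -> unit_interval t) ->
  forall F s, exists d, Forall2 (fun t v => Rabs (q t - v) <= (/ 2) ^ M) ts d /\
    exec (sampling_program M ts F) q s = Outcome (F d) (length ts) (length ts * M) /\
    safe (sampling_program M ts F) q s.
Proof.
intros Hq; induction ts as [|t ts IH]; intros Ht F s.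
  exists []; repeat split; constructor.
simpl.
assert (Ut : unit_interval t) by (apply Ht; left; reflexivity).
set (k := fun v => sampling_program M ts (fun d => F (v :: d))).
set (s' := write s 0 (q t)).
destruct (round_program_spec M 0 1 k q s') as [v [E1 [E2 E3]]].
  apply (proj1 Hq t Ut).
destruct (IH (fun t Hin => Ht t (or_intror Hin)) (fun d => F (v :: d)) s')
  as [d [D1 [D2 D3]]].
exists (v :: d); split; [|split; [|split; [exact Ut|apply E3, D3]]].
  constructor; [|exact D1].
  apply Rle_trans with (1 := E1); lra.
rewrite E2; unfold k; rewrite D2; reflexivity.
Qed.

Lemma comp_wor_le (n M : nat) (c eps : R) :
  (0 < n)%nat -> 2 * (/ 2) ^ M + / (4 * INR n ^ 2) <= eps ->
  Rbar_le (comp_wor c eps) (c * INR (S n) + INR (S n) * INR M).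
Proof.
intros Hn Heps; apply (proj1 (Glb_Rbar_correct _)).
set (P := sampling_program M (nodes n) (consistent_value ((/ 2) ^ M) (nodes n))).
assert (HP : forall q, classQ q -> exists d,
  consistent ((/ 2) ^ M) (nodes n) d q /\
  run P q = Outcome (consistent_value ((/ 2) ^ M) (nodes n) d) (S n) (S n * M) /\
  safe P q init).
  intros q Hq.
  destruct (sampling_program_spec M (nodes n) q Hq) with
    (F := consistent_value ((/ 2) ^ M) (nodes n)) (s := init) as [d [D1 [D2 D3]]].
    intros t Ht; apply in_map_iff in Ht; destruct Ht as [i [<- _]]; apply clamp_unit.
  exists d; split; [split; assumption|]; split; [|exact D3].
  unfold run, P; rewrite D2; unfold nodes; rewrite length_map, length_seq; reflexivity.
exists P; split; [|split].
- intros q Hq; destruct (HP q Hq) as [d [_ [_ D]]]; exact D.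
- apply worst_error_le; intros q v Hq ->.
  destruct (HP q Hq) as [d [D [-> _]]]; simpl value.
  apply Rle_trans with (2 := Heps), consistent_value_error; assumption.
(* Every potential incurs the same cost, so the supremum is this value, attained for instance at the
   zero potential. *)
- apply is_lub_Rbar_unique; split.
    intros r [q [Hq ->]]; destruct (HP q Hq) as [d [_ [-> _]]]; simpl queries.
    simpl operations; rewrite <- mult_INR; apply Rle_refl.
  intros b Hb; apply Hb; exists (fun _ => 0); split; [apply classQ_zero|].
  destruct (HP _ classQ_zero) as [d [_ [-> _]]]; simpl queries; simpl operations.
  rewrite <- mult_INR; reflexivity.
Qed.

(** * Choice of the grid size and of the rounding depth *)

Lemma Rpower_half_sq (eps : R) :
  0 < eps -> Rpower eps (- (1 / 2)) * Rpower eps (- (1 / 2)) = / eps.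
Proof.
intros H; rewrite <- Rpower_plus.
replace (- (1 / 2) + - (1 / 2)) with (- (1)) by field.
rewrite Rpower_Ropp, Rpower_1; auto.
Qed.

(** For [X = eps^(-1/2)] the witness is the floor of [X] plus 1. Since [X >= 1], the number of nodes
    is at most [X + 2 <= 3 X]. *)
Lemma grid_size (eps : R) :
  0 < eps < 1 / 2 -> exists n, (0 < n)%nat /\ / (4 * INR n ^ 2) <= eps / 4 /\
    INR (S n) <= 3 * Rpower eps (- (1 / 2)).
Proof.
intros He; assert (HX := Rpower_half_sq eps (proj1 He)).
set (X := Rpower eps (- (1 / 2))) in *.
assert (X0 : 0 < X) by apply exp_pos.
assert (Hi : 1 <= / eps) by (rewrite <- Rinv_1; apply Rinv_le_contravar; lra).
assert (X1 : 1 <= X) by nra.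
destruct (nfloor_ex X) as [n [N1 N2]]; [lra|].
exists (S n); split; [lia|]; rewrite !S_INR; split; [|lra].
assert (Hp : X * X <= (INR n + 1) ^ 2) by nra.
apply Rle_trans with (/ (4 * (X * X))).
  apply Rinv_le_contravar; nra.
rewrite HX; apply Req_le; field; lra.
Qed.

(** The depth is the floor of [log2 (/ eps) + 2], plus 1; the 2 accounts for the factor 4. For
    [eps < 1/2] the logarithm is at least 1 and absorbs the additive 3. *)
Lemma rounding_depth (eps : R) :
  0 < eps < 1 / 2 -> exists M, (/ 2) ^ M <= eps / 4 /\ INR M <= 4 * log2 (/ eps).
Proof.
intros He.
assert (L2 : 0 < ln 2) by (rewrite <- ln_1; apply ln_increasing; lra).
assert (Hi : 2 < / eps).
  rewrite <- (Rinv_inv 2); apply Rinv_lt_contravar; [|lra].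
  apply Rmult_lt_0_compat; lra.
assert (HL : 1 <= log2 (/ eps)).
  unfold log2; apply Rle_div_r; [exact L2|].
  rewrite Rmult_1_l; apply Rlt_le, ln_increasing; lra.
destruct (nfloor_ex (log2 (/ eps) + 2)) as [M [M1 M2]]; [lra|].
exists (S M); rewrite S_INR; split; [|lra].
assert (P : 4 * / eps <= 2 ^ S M).
  rewrite <- (exp_ln (4 * / eps)) by lra.
  rewrite <- (Rpower_pow (S M) 2) by lra; unfold Rpower.
  destruct (Rle_lt_or_eq_dec (ln (4 * / eps)) (INR (S M) * ln 2)) as [H| ->].
  - rewrite ln_mult by lra.
    replace 4 with (2 * 2) at 1 by ring; rewrite ln_mult by lra.
    rewrite S_INR; unfold log2 in M2.
    assert (ln (/ eps) = ln (/ eps) / ln 2 * ln 2) by (field; lra).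
    nra.
  - apply Rlt_le, exp_increasing, H.
  - apply Rle_refl.
rewrite pow_inv.
replace (eps / 4) with (/ (4 * / eps)) by (field; lra).
apply Rinv_le_contravar; lra.
Qed.

(** * Fooling potentials *)

Fixpoint sum_below (g : nat -> R) (N : nat) : R :=
  match N with O => 0 | S k => sum_below g k + g k end.

Lemma sum_below_le (g k : nat -> R) (N : nat) :
  (forall i, (i < N)%nat -> g i <= k i) -> sum_below g N <= sum_below k N.
Proof.
induction N as [|N IH]; intros H; simpl; [lra|].
apply Rplus_le_compat; auto.
Qed.

Lemma sum_below_scal (c : R) (g : nat -> R) (N : nat) :
  sum_below (fun i => g i * c) N = sum_below g N * c.
Proof. induction N as [|N IH]; simpl; [ring|rewrite IH; ring]. Qed.

Lemma sum_below_plus (g k : nat -> R) (N : nat) :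
  sum_below (fun i => g i + k i) N = sum_below g N + sum_below k N.
Proof. induction N as [|N IH]; simpl; [ring|rewrite IH; ring]. Qed.

Lemma sum_below_zero (N : nat) : sum_below (fun _ => 0) N = 0.
Proof. induction N as [|N IH]; simpl; [ring|rewrite IH; ring]. Qed.

Lemma sum_below_one (N : nat) : sum_below (fun _ => 1) N = INR N.
Proof. induction N as [|N IH]; [reflexivity|rewrite S_INR; simpl; rewrite IH; ring]. Qed.

Lemma sum_below_derive (g g1 : nat -> R -> R) (N : nat) (x : R) :
  (forall i, is_derive (g i) x (g1 i x)) ->
  is_derive (fun y => sum_below (fun i => g i y) N) x (sum_below (fun i => g1 i x) N).
Proof.
intros H; induction N as [|N IH]; simpl; [apply @is_derive_const|].
apply (is_derive_plus (fun y => sum_below (fun i => g i y) N) (g N)); auto.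
Qed.

Lemma sum_below_continuous (g : nat -> R -> R) (N : nat) (x : R) :
  (forall i, continuous (g i) x) -> continuous (fun y => sum_below (fun i => g i y) N) x.
Proof.
intros H; induction N as [|N IH]; simpl; [apply continuous_const|].
apply (continuous_plus (fun y => sum_below (fun i => g i y) N) (g N)); auto.
Qed.

Definition grid (a h : R) (k : nat) : R := a + INR k * h.

(** The cells are disjoint, so at most one term is nonzero: once [x] reaches the left end of a cell,
    all terms of earlier cells vanish. *)
Lemma sum_below_disjoint (g : nat -> R) (a h x B : R) (N : nat) :
  0 < h -> 0 <= B ->
  (forall k, ~ (grid a h k < x < grid a h (S k)) -> g k = 0) ->
  (forall k, Rabs (g k) <= B) -> Rabs (sum_below g N) <= B.
Proof.
intros Hh HB Hg Hb.
assert (Z : forall n, grid a h n <= x -> sum_below g n = 0).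
  induction n as [|n IH]; [reflexivity|]; intros Hn; simpl.
  rewrite (Hg n) by lra; rewrite IH; [ring|].
  unfold grid in *; rewrite S_INR in Hn; lra.
induction N as [|N IH]; simpl; [rewrite Rabs_R0; exact HB|].
destruct (Rlt_le_dec (grid a h N) x) as [H|H].
  rewrite Z, Rplus_0_l by lra; apply Hb.
rewrite (Hg N) by lra; rewrite Rplus_0_r; exact IH.
Qed.

(** An exponent of at least 2 smooths the kink of the positive part, where the derivative is 0. *)
Lemma is_derive_pos_part_pow (n : nat) (y : R) :
  is_derive (fun z => Rmax 0 z ^ S (S n)) y (INR (S (S n)) * Rmax 0 y ^ S n).
Proof.
destruct (Rtotal_order y 0) as [H|[->|H]].
- rewrite Rmax_left, pow_ne_zero, Rmult_0_r by (lra || lia).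
  apply is_derive_ext_loc with (fun _ => 0); [|apply @is_derive_const].
  exists (mkposreal (- y) ltac:(lra)); intros z Hz.
  apply Rabs_def2 in Hz; simpl in Hz; unfold minus, plus, opp in Hz; simpl in Hz.
  rewrite Rmax_left, pow_ne_zero by (lra || lia); reflexivity.
- rewrite Rmax_left, pow_ne_zero, Rmult_0_r by (lra || lia).
  apply is_derive_Reals; intros e He.
  assert (Hd : 0 < Rmin e 1) by (apply Rmin_glb_lt; lra).
  exists (mkposreal _ Hd); simpl pos; intros h Hh0 Hh.
  assert (A := Rmin_l e 1); assert (B := Rmin_r e 1).
  rewrite Rplus_0_l, (Rmax_left 0 0), (pow_ne_zero (S (S n))) by (lra || lia).
  rewrite !Rminus_0_r.
  destruct (Rle_lt_dec h 0) as [Hn|Hp].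
    rewrite Rmax_left, pow_ne_zero by (lra || lia).
    unfold Rdiv; rewrite Rmult_0_l, Rabs_R0; exact He.
  rewrite Rmax_right by lra.
  replace (h ^ S (S n) / h) with (h * h ^ n) by (simpl; field; lra).
  rewrite Rabs_pos_eq in Hh by lra.
  assert (P : 0 <= h ^ n <= 1).
    split; [apply pow_le; lra|].
    rewrite <- (pow1 n); apply pow_incr; lra.
  rewrite Rabs_pos_eq by nra; nra.
- rewrite Rmax_right by lra.
  apply is_derive_ext_loc with (fun z => z ^ S (S n)).
    exists (mkposreal y H); intros z Hz.
    apply Rabs_def2 in Hz; simpl in Hz; unfold minus, plus, opp in Hz; simpl in Hz.
    rewrite Rmax_right by lra; reflexivity.
  apply is_derive_Reals, derivable_pt_lim_pow.
Qed.

Lemma continuous_pos_part (y : R) : continuous (Rmax 0) y.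
Proof.
apply continuous_eps; intros e He; exists e; split; [exact He|]; intros z Hz.
apply Rle_lt_trans with (2 := Hz).
unfold Rmax; destruct (Rle_dec 0 z); destruct (Rle_dec 0 y);
  unfold Rabs; repeat destruct (Rcase_abs _); lra.
Qed.

(** * Bumps of class C^2 supported in one cell *)

Definition arch (a h x : R) : R := (x - a) / h - ((x - a) / h) ^ 2.

(** With [s = (x - a) / h], the arch [s (1 - s)] is positive exactly for [0 < s < 1]. The cube gives
    two continuous derivatives, and [h ^ 2] keeps the second one bounded independently of [h]. *)
Definition bump (a h x : R) : R := h ^ 2 / 2 * Rmax 0 (arch a h x) ^ 3.

Definition bump1 (a h x : R) : R :=
  3 * h / 2 * (Rmax 0 (arch a h x) ^ 2 * (1 - 2 * ((x - a) / h))).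

Definition bump2 (a h x : R) : R :=
  3 * (Rmax 0 (arch a h x) * (1 - 2 * ((x - a) / h)) ^ 2 - Rmax 0 (arch a h x) ^ 2).

Lemma arch_derive (a h x : R) :
  0 < h -> is_derive (arch a h) x ((1 - 2 * ((x - a) / h)) / h).
Proof. intros Hh; unfold arch; auto_derive; [exact I|field; lra]. Qed.

Lemma pos_part_arch_pow_derive (a h x : R) (n : nat) :
  0 < h ->
  is_derive (fun z => Rmax 0 (arch a h z) ^ S (S n)) x
    ((1 - 2 * ((x - a) / h)) / h * (INR (S (S n)) * Rmax 0 (arch a h x) ^ S n)).
Proof.
intros Hh; apply (is_derive_comp (fun y => Rmax 0 y ^ S (S n)) (arch a h)).
  apply is_derive_pos_part_pow.
apply arch_derive, Hh.
Qed.

Lemma bump_derive (a h x : R) : 0 < h -> is_derive (bump a h) x (bump1 a h x).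
Proof.
intros Hh; unfold bump1.
replace (3 * h / 2 * (Rmax 0 (arch a h x) ^ 2 * (1 - 2 * ((x - a) / h)))) with
  (h ^ 2 / 2 * ((1 - 2 * ((x - a) / h)) / h * (INR 3 * Rmax 0 (arch a h x) ^ 2)))
  by (simpl INR; field; lra).
apply (is_derive_scal (fun z => Rmax 0 (arch a h z) ^ 3)).
apply pos_part_arch_pow_derive, Hh.
Qed.

Lemma bump1_derive (a h x : R) : 0 < h -> is_derive (bump1 a h) x (bump2 a h x).
Proof.
intros Hh; unfold bump2.
replace (3 * (Rmax 0 (arch a h x) * (1 - 2 * ((x - a) / h)) ^ 2 -
              Rmax 0 (arch a h x) ^ 2)) with
  (3 * h / 2 * ((1 - 2 * ((x - a) / h)) / h * (INR 2 * Rmax 0 (arch a h x) ^ 1)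
       * (1 - 2 * ((x - a) / h)) + Rmax 0 (arch a h x) ^ 2 * (- 2 / h)))
  by (simpl INR; field; lra).
apply (is_derive_scal
  (fun z => Rmax 0 (arch a h z) ^ 2 * (1 - 2 * ((z - a) / h)))).
apply (is_derive_mult (fun z => Rmax 0 (arch a h z) ^ 2)
  (fun z => 1 - 2 * ((z - a) / h))); [|auto_derive; [exact I|field; lra]|
  intros; apply Rmult_comm].
apply pos_part_arch_pow_derive, Hh.
Qed.

Lemma bump2_continuous (a h x : R) : 0 < h -> continuous (bump2 a h) x.
Proof.
intros Hh.
assert (Cm : continuous (fun z => Rmax 0 (arch a h z)) x).
  apply (continuous_comp (arch a h) (Rmax 0)); [|apply continuous_pos_part].
  eapply continuous_is_derive, arch_derive, Hh.
apply (continuous_mult (fun _ => 3)); [apply continuous_const|].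
apply (continuous_minus (fun z => Rmax 0 (arch a h z) * (1 - 2 * ((z - a) / h)) ^ 2)
  (fun z => Rmax 0 (arch a h z) ^ 2)).
  apply (continuous_mult (fun z => Rmax 0 (arch a h z))); [exact Cm|].
  apply (ex_derive_continuous (fun z => (1 - 2 * ((z - a) / h)) ^ 2)).
  auto_derive; exact I.
apply continuous_ext with (fun z => Rmax 0 (arch a h z) * Rmax 0 (arch a h z)).
  intros; simpl; ring.
apply (continuous_mult (fun z => Rmax 0 (arch a h z))); exact Cm.
Qed.

Lemma bump_nonneg (a h x : R) : 0 <= bump a h x.
Proof.
apply Rmult_le_pos; [assert (H := pow2_ge_0 h); lra|apply pow_le, Rmax_l].
Qed.

Lemma arch_nonpos (a h x : R) :
  0 < h -> ~ (a < x < a + h) -> Rmax 0 (arch a h x) = 0.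
Proof.
intros Hh Hx; apply Rmax_left; unfold arch.
assert (E : x - a = (x - a) / h * h) by (field; lra).
set (s := (x - a) / h) in *; destruct (Rle_lt_dec s 0); [nra|].
destruct (Rle_lt_dec 1 s); [nra|].
exfalso; apply Hx; split; nra.
Qed.

Lemma bump_support (a h x : R) :
  0 < h -> ~ (a < x < a + h) ->
  bump a h x = 0 /\ bump1 a h x = 0 /\ bump2 a h x = 0.
Proof.
intros Hh Hx; unfold bump, bump1, bump2; rewrite arch_nonpos by assumption.
repeat split; ring.
Qed.

(** Where the positive part [m] of the arch is nonzero, [(1 - 2 s)^2 = 1 - 4 m] and [m <= 1/4],
    which reduces the estimates to polynomial inequalities in [m]. *)
Lemma bump_bounds (a h x : R) :
  0 < h <= 1 ->
  Rabs (bump a h x) <= 1 /\ Rabs (bump1 a h x) <= 1 /\ Rabs (bump2 a h x) <= 1.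
Proof.
intros Hh.
assert (Hm : Rmax 0 (arch a h x) = 0 \/
  (0 <= Rmax 0 (arch a h x) <= / 4 /\
   (1 - 2 * ((x - a) / h)) ^ 2 = 1 - 4 * Rmax 0 (arch a h x))).
  unfold arch; set (s := (x - a) / h).
  destruct (Rle_lt_dec (s - s ^ 2) 0); [left; apply Rmax_left; assumption|right].
  rewrite Rmax_right by lra; assert (H := pow2_ge_0 (s - 1 / 2)); split; [nra|ring].
unfold bump, bump1, bump2; destruct Hm as [->|[Hm E]].
  replace (h ^ 2 / 2 * 0 ^ 3) with 0 by ring.
  replace (3 * h / 2 * (0 ^ 2 * (1 - 2 * ((x - a) / h)))) with 0 by ring.
  replace (3 * (0 * (1 - 2 * ((x - a) / h)) ^ 2 - 0 ^ 2)) with 0 by ring.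
  rewrite Rabs_R0; lra.
rewrite E; set (m := Rmax 0 (arch a h x)) in *.
set (c := 1 - 2 * ((x - a) / h)) in *.
assert (Hc : -1 <= c <= 1) by (clearbody c; split; nra).
assert (Hm2 : 0 <= m ^ 2 <= / 16) by nra.
assert (Hm3 : 0 <= m ^ 3 <= / 64) by (replace (m ^ 3) with (m * m ^ 2) by ring; nra).
assert (Hh2 : 0 < h ^ 2 <= 1) by nra.
split; [|split]; apply Rabs_le.
- split; nra.
- assert (- / 16 <= m ^ 2 * c <= / 16) by (split; nra).
  split; nra.
- split; nra.
Qed.

(** On the middle half of the cell the arch is at least 3/16, and [27 / 8192] is [(3/16)^3 / 2]. *)
Lemma bump_lower (a h x : R) :
  0 < h -> a + h / 4 <= x <= a + 3 * h / 4 -> 27 / 8192 * h ^ 2 <= bump a h x.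
Proof.
intros Hh Hx; unfold bump.
assert (Hm : 3 / 16 <= Rmax 0 (arch a h x)).
  apply Rle_trans with (2 := Rmax_r _ _); unfold arch.
  assert (E : x - a = (x - a) / h * h) by (field; lra).
  set (s := (x - a) / h) in *.
  assert (1 / 4 <= s <= 3 / 4) by (split; nra).
  nra.
assert (H3 : (3 / 16) ^ 3 <= Rmax 0 (arch a h x) ^ 3) by (apply pow_incr; lra).
replace (27 / 8192 * h ^ 2) with (h ^ 2 / 2 * (3 / 16) ^ 3) by field.
assert (Hp := pow2_ge_0 h).
apply Rmult_le_compat_l; [lra|exact H3].
Qed.

Section Adversary.
Variables (ts : list R) (a h : R) (N : nat).
Hypothesis h_range : 0 < h <= 1.

(** Real-valued, so that it can be summed over points and over cells. The cell is open: a sample on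
    its boundary does not see the bump. *)
Definition in_cell (k : nat) (t : R) : R :=
  if Rlt_dec (grid a h k) t then if Rlt_dec t (grid a h (S k)) then 1 else 0 else 0.

Fixpoint occupancy (l : list R) (k : nat) : R :=
  match l with [] => 0 | t :: l' => in_cell k t + occupancy l' k end.

(** 1 on the cells free of points of [ts], 0 on the others. *)
Definition free_cell (k : nat) : R := Rmax 0 (1 - occupancy ts k).

Definition adversary (x : R) : R :=
  sum_below (fun k => free_cell k * bump (grid a h k) h x) N.

Lemma in_cell_range (k : nat) (t : R) : 0 <= in_cell k t <= 1.
Proof.
unfold in_cell; destruct (Rlt_dec _ _); [destruct (Rlt_dec _ _)|]; lra.
Qed.

Lemma occupancy_nonneg (l : list R) (k : nat) : 0 <= occupancy l k.
Proof.
induction l as [|t l IH]; simpl; [lra|]; destruct (in_cell_range k t); lra.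
Qed.

Lemma free_cell_range (k : nat) : 0 <= free_cell k <= 1.
Proof.
assert (H := occupancy_nonneg ts k).
split; [apply Rmax_l|apply Rmax_lub; lra].
Qed.

Lemma occupied_cell (t : R) (k : nat) :
  In t ts -> grid a h k < t < grid a h (S k) -> free_cell k = 0.
Proof.
intros Ht Hk; apply Rmax_left.
assert (1 <= occupancy ts k); [|lra].
induction ts as [|s l IH]; [destruct Ht|]; destruct Ht as [->|Ht]; simpl.
  unfold in_cell; destruct (Rlt_dec _ _); [destruct (Rlt_dec _ _)|]; try lra.
  assert (H := occupancy_nonneg l k); lra.
destruct (in_cell_range k s); specialize (IH Ht); lra.
Qed.

(** Double counting: each point lies in at most one open cell, so the total occupancy is at most the
    number of points, and [free_cell] is at least 1 minus the occupancy. *)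
Lemma free_cells_count : INR N - INR (length ts) <= sum_below free_cell N.
Proof.
assert (Occ : sum_below (occupancy ts) N <= INR (length ts)).
  induction ts as [|t l IH]; simpl occupancy.
    rewrite sum_below_zero; simpl; lra.
  rewrite sum_below_plus; simpl length; rewrite S_INR.
  assert (Rabs (sum_below (fun k => in_cell k t) N) <= 1).
    apply (sum_below_disjoint _ a h t); [lra|lra| |].
      intros k Hk; unfold in_cell.
      destruct (Rlt_dec _ _); [destruct (Rlt_dec _ _)|]; auto; lra.
    intros k; destruct (in_cell_range k t); apply Rabs_le; lra.
  apply Rabs_le_between in H; lra.
assert (sum_below (fun k => 1 + occupancy ts k * -1) N <= sum_below free_cell N).
  apply sum_below_le; intros k _; apply Rle_trans with (2 := Rmax_r _ _); lra.
rewrite sum_below_plus, sum_below_scal, sum_below_one in H; lra.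
Qed.

Lemma grid_succ (k : nat) : grid a h (S k) = grid a h k + h.
Proof. unfold grid; rewrite S_INR; ring. Qed.

Lemma adversary_zero (t : R) : In t ts -> adversary t = 0.
Proof.
intros Ht; rewrite <- (sum_below_zero N); unfold adversary.
(* Every term vanishes at [t]: inside the cell the weight is 0, outside it the bump is 0. *)
apply Rle_antisym; apply sum_below_le; intros k _;
  (destruct (Rlt_dec (grid a h k) t);
   [destruct (Rlt_dec t (grid a h (S k)));
    [rewrite (occupied_cell t k) by auto; lra|]|];
   rewrite (proj1 (bump_support (grid a h k) h t ltac:(lra) ltac:(rewrite <- grid_succ; lra))); lra).
Qed.

(** A generic [g] covers the bump and its two derivatives at once. *)
Lemma free_bump_sum_bound (g : R -> R -> R -> R) (x : R) :
  (forall b, Rabs (g b h x) <= 1) ->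
  (forall b, ~ (b < x < b + h) -> g b h x = 0) ->
  Rabs (sum_below (fun k => free_cell k * g (grid a h k) h x) N) <= 1.
Proof.
intros Hb Hs; apply (sum_below_disjoint _ a h x); [lra|lra| |].
  intros k Hk; rewrite Hs; [ring|rewrite <- grid_succ; exact Hk].
intros k; rewrite Rabs_mult; destruct (free_cell_range k).
rewrite (Rabs_pos_eq (free_cell k)) by assumption.
specialize (Hb (grid a h k)); assert (H' := Rabs_pos (g (grid a h k) h x)); nra.
Qed.

Lemma adversary_derive (x : R) :
  is_derive adversary x
    (sum_below (fun k => free_cell k * bump1 (grid a h k) h x) N).
Proof.
apply (sum_below_derive (fun k x => free_cell k * bump (grid a h k) h x)
  (fun k x => free_cell k * bump1 (grid a h k) h x)).
intros k; apply (is_derive_scal (bump (grid a h k) h)), bump_derive; lra.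
Qed.

Lemma adversary_continuous (x : R) : continuous adversary x.
Proof. eapply continuous_is_derive, adversary_derive. Qed.

Lemma adversary_classQ : classQ adversary.
Proof.
set (f1 := fun x => sum_below (fun k => free_cell k * bump1 (grid a h k) h x) N).
set (f2 := fun x => sum_below (fun k => free_cell k * bump2 (grid a h k) h x) N).
assert (B : forall x, Rabs (adversary x) <= 1 /\ Rabs (f1 x) <= 1 /\ Rabs (f2 x) <= 1).
  intros x; split; [|split]; apply free_bump_sum_bound; intros b.
  - apply bump_bounds, h_range.
  - intros Hb; apply bump_support; lra.
  - apply bump_bounds, h_range.
  - intros Hb; apply bump_support; lra.
  - apply bump_bounds, h_range.
  - intros Hb; apply bump_support; lra.
split.
  intros x _; split.
    rewrite <- (sum_below_zero N); apply sum_below_le; intros k _.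
    apply Rmult_le_pos; [apply free_cell_range|apply bump_nonneg].
  apply Rle_trans with (1 := Rle_abs _), B.
exists f1, f2; split; [|intros x _; apply B].
intros x _; split; [|split].
- apply is_derive_D_in, adversary_derive.
- apply is_derive_D_in.
  apply (sum_below_derive (fun k x => free_cell k * bump1 (grid a h k) h x)
    (fun k x => free_cell k * bump2 (grid a h k) h x)).
  intros k; apply (is_derive_scal (bump1 (grid a h k) h)), bump1_derive; lra.
- apply continuous_continue_in.
  apply (sum_below_continuous (fun k x => free_cell k * bump2 (grid a h k) h x)).
  intros k; apply (continuous_mult (fun _ => free_cell k)); [apply continuous_const|].
  apply bump2_continuous; lra.
Qed.
End Adversary.

(** * Lower bounds *)

Lemma ex_RInt_everywhere (g : R -> R) (a b : R) :
  (forall x, continuous g x) -> ex_RInt g a b.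
Proof. intros Cg; apply (@ex_RInt_continuous R_CompleteNormedModule); auto. Qed.

Lemma RInt_ge_on_subinterval (g : R -> R) (c d m : R) :
  (forall x, continuous g x) -> (forall x, unit_interval x -> 0 <= g x) ->
  0 <= c -> c <= d -> d <= 1 -> (forall x, c <= x <= d -> m <= g x) ->
  (d - c) * m <= RInt g 0 1.
Proof.
intros Cg Pg Hc Hcd Hd Hm; unfold unit_interval in Pg.
assert (Ex := fun a b => ex_RInt_everywhere g a b Cg).
rewrite <- (RInt_Chasles g 0 c 1), <- (RInt_Chasles g c d 1) by auto.
unfold plus; simpl.
assert (A : 0 <= RInt g 0 c) by (apply RInt_ge_0; auto; intros; apply Pg; lra).
assert (B : 0 <= RInt g d 1) by (apply RInt_ge_0; auto; intros; apply Pg; lra).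
assert (C : RInt (fun _ => m) c d <= RInt g c d).
  apply RInt_le; auto; [apply ex_RInt_everywhere; intros; apply continuous_const|].
  intros; apply Hm; lra.
rewrite (RInt_const (V := R_CompleteNormedModule)) in C.
unfold scal in C; simpl in C; unfold mult in C; simpl in C; lra.
Qed.

Lemma RInt_sum_below (g : nat -> R -> R) (N : nat) :
  (forall k x, continuous (g k) x) ->
  RInt (fun x => sum_below (fun k => g k x) N) 0 1 = sum_below (fun k => RInt (g k) 0 1) N.
Proof.
intros Cg; induction N as [|N IH]; simpl.
  rewrite (RInt_const (V := R_CompleteNormedModule)).
  unfold scal; simpl; unfold mult; simpl; ring.
rewrite <- IH; apply (RInt_plus (fun x => sum_below (fun k => g k x) N) (g N));
  apply ex_RInt_everywhere; auto.
intros; apply sum_below_continuous; auto.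
Qed.

(** [u'' = (q - l) u <= 0], so [u] is concave and lies above the chords joining its maximum to its
    zeros at 0 and 1; on [1/4,3/4] these have height at least a quarter of the maximum. *)
Lemma ground_state_middle (q u u1 : R -> R) (l : R) :
  (forall x, unit_interval x -> q x <= l) -> ground_state (fun x => q x - l) u u1 ->
  exists M, 0 < M /\ (forall x, unit_interval x -> 0 <= u x <= M) /\
    forall x, 1 / 4 <= x <= 3 / 4 -> M / 4 <= u x.
Proof.
intros Hql [[U0 [_ [Hu Hu1]]] [U1 Pu]].
destruct (continuity_ab_maj u 0 1) as [xm [Hmax Hxm]]; [lra| |].
  intros x _; apply continuity_pt_filterlim; eapply continuous_is_derive, Hu.
assert (HM : 0 < u xm).
  specialize (Hmax (1 / 2) ltac:(lra)); specialize (Pu (1 / 2) ltac:(lra)); lra.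
assert (Pos : forall x, unit_interval x -> 0 <= u x).
  intros x Hx; unfold unit_interval in Hx.
  destruct (Req_dec x 0) as [->|]; [lra|]; destruct (Req_dec x 1) as [->|]; [lra|].
  apply Rlt_le, Pu; lra.
exists (u xm); split; [exact HM|]; split; [intros x Hx; auto|].
assert (Chord : forall a b x, 0 <= a -> b <= 1 -> a <= x <= b ->
  (b - x) * u a + (x - a) * u b <= (b - a) * u x).
  intros a b x Ha Hb Hx.
  apply (concave_chord u u1 (fun x => (q x - l) * u x)); auto.
    intros y Hy; apply Hu1; unfold unit_interval; lra.
  intros y Hy; assert (Uy : unit_interval y) by (unfold unit_interval; lra).
  specialize (Hql y Uy); specialize (Pos y Uy); nra.
intros x Hx; destruct (Rle_lt_dec x xm) as [H|H].
  assert (C := Chord 0 xm x ltac:(lra) ltac:(lra) ltac:(lra)); rewrite U0 in C.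
  assert (P := Pos x ltac:(unfold unit_interval; lra)); nra.
assert (C := Chord xm 1 x ltac:(lra) ltac:(lra) ltac:(lra)); rewrite U1 in C.
assert (P := Pos x ltac:(unfold unit_interval; lra)); nra.
Qed.

(* Integrating the derivative [(mu - la - f) u w] of the Wronskian. *)
Lemma wronskian_integral (f u u1 w w1 : R -> R) (la mu : R) :
  (forall x, continuous f x) ->
  ground_state (fun _ => 0 - la) u u1 -> ground_state (fun x => f x - mu) w w1 ->
  RInt (fun x => f x * (u x * w x)) 0 1 = (mu - la) * RInt (fun x => u x * w x) 0 1.
Proof.
intros Cf [[U0 [_ [Hu Hu1]]] [U1 _]] [[W0 [_ [Hw Hw1]]] [W1 _]].
assert (Co : forall x, continuous (fun x => u x * w x) x).
  intros x; apply (continuous_mult u w); eapply continuous_is_derive; auto.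
assert (Cfo : forall x, continuous (fun x => f x * (u x * w x)) x).
  intros x; apply (continuous_mult f (fun x => u x * w x)); auto.
assert (Cdo : forall x, continuous (fun x => (mu - la) * (u x * w x)) x).
  intros x; apply (continuous_mult (fun _ => mu - la)); auto using continuous_const.
assert (I := is_RInt_derive (fun x => u1 x * w x - u x * w1 x)
  (fun x => minus ((mu - la) * (u x * w x)) (f x * (u x * w x))) 0 1).
rewrite Rmin_left, Rmax_right in I by lra.
assert (I' := is_RInt_unique _ _ _ _ (I
  ltac:(intros x Hx;
    replace (minus ((mu - la) * (u x * w x)) (f x * (u x * w x))) with
      (((0 - la) * u x * w x + u1 x * w1 x) - (u1 x * w1 x + u x * ((f x - mu) * w x)))
      by (unfold minus, plus, opp; simpl; ring);
    apply (is_derive_minus (fun x => u1 x * w x) (fun x => u x * w1 x));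
    [apply (is_derive_mult u1 w)|apply (is_derive_mult u w1)]; auto;
    intros; apply Rmult_comm)
  ltac:(intros x _; apply (continuous_minus (fun x => (mu - la) * (u x * w x))
          (fun x => f x * (u x * w x))); auto))).
rewrite (RInt_minus (V := R_CompleteNormedModule)) in I'
  by (apply ex_RInt_everywhere; auto).
rewrite (RInt_scal (V := R_CompleteNormedModule) (fun x => u x * w x)) in I'
  by (apply ex_RInt_everywhere; auto).
(* Both eigenfunctions vanish at 0 and 1, so the Wronskian has no boundary terms. *)
rewrite U0, U1, W0, W1 in I'.
unfold minus, plus, opp, scal in I'; simpl in I'; unfold mult in I'; simpl in I'.
lra.
Qed.

(** In the Wronskian identity the free bumps bound [int f u w] from below by a multiple of [A B],
    and [A B] bounds [int u w] from above, so the unknown maxima of the eigenfunctions cancel. *)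
Lemma lambda_gap (ts : list R) :
  exists q, classQ q /\ (forall t, In t ts -> q t = 0) /\
    / 1000000 / (INR (length ts) + 1) ^ 2 <= lambda q - lambda (fun _ => 0).
Proof.
set (n := length ts); set (N := (2 * (n + 1))%nat).
assert (Hn := pos_INR n).
assert (EN : INR N = 2 * (INR n + 1))
  by (unfold N; rewrite mult_INR, plus_INR; simpl; ring).
set (h := / (2 * INR N)).
assert (Hh0 : 0 < h) by (apply Rinv_0_lt_compat; lra).
assert (EhN : h * INR N = 1 / 2) by (unfold h; field; lra).
assert (Hh : 0 < h <= 1) by (split; [exact Hh0|nra]).
set (f := adversary ts (1 / 4) h N).
assert (Qf : classQ f) by (apply adversary_classQ, Hh).
exists f; split; [exact Qf|]; split; [intros t; apply adversary_zero, Hh|].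
destruct (lambda_ground_state _ classQ_zero) as [u [u1 Gu]].
destruct (lambda_ground_state f Qf) as [w [w1 Gw]].
(* The eigenvalue dominates the potential, as concavity of the eigenfunctions requires. *)
assert (L1 : forall q, classQ q -> 1 <= lambda q).
  intros q Hq; apply Rle_trans with (2 := lambda_ge_PI2 q Hq).
  assert (H := PI2_3_2); nra.
assert (Cf : forall x, continuous f x) by (intros; apply adversary_continuous, Hh).
assert (E := wronskian_integral f u u1 w w1 _ _ Cf Gu Gw).
destruct (ground_state_middle (fun _ => 0) u u1 (lambda (fun _ => 0)))
  as [A [HA [BA LA]]]; [intros; specialize (L1 _ classQ_zero); lra|exact Gu|].
destruct (ground_state_middle f w w1 (lambda f)) as [B [HB [BB LB]]];
  [intros x Hx; specialize (L1 f Qf); destruct (proj1 Qf x Hx); lra|exact Gw|].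
set (D := lambda f - lambda (fun _ => 0)) in *.
assert (Co : forall x, continuous (fun x => u x * w x) x).
  intros x; apply (continuous_mult u w); eapply continuous_is_derive;
    [apply Gu|apply Gw].
assert (Po : forall x, unit_interval x -> 0 <= u x * w x <= A * B).
  intros x Hx; destruct (BA x Hx); destruct (BB x Hx); split;
    [apply Rmult_le_pos|apply Rmult_le_compat]; assumption.
assert (Cb : forall k x, continuous (fun x => bump (grid (1 / 4) h k) h x * (u x * w x)) x).
  intros k x; apply (continuous_mult (bump (grid (1 / 4) h k) h)); [|apply Co].
  eapply continuous_is_derive, bump_derive, Hh0.
(* What one free cell contributes at least: half its length times the lower bounds of the bump and
   of [u w]. *)
set (m := h / 2 * (27 / 8192 * h ^ 2 * (A * B / 16))).
assert (HAB : 0 < A * B) by (apply Rmult_lt_0_compat; assumption).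
assert (Low : INR N / 2 * m <= RInt (fun x => f x * (u x * w x)) 0 1).
  rewrite (RInt_ext _ (fun x => sum_below (fun k => free_cell ts (1 / 4) h k *
    (bump (grid (1 / 4) h k) h x * (u x * w x))) N)).
  2: { intros x _; unfold f, adversary.
       rewrite <- sum_below_scal; f_equal.
       apply functional_extensionality; intros; ring. }
  rewrite (RInt_sum_below (fun k x => free_cell ts (1 / 4) h k *
    (bump (grid (1 / 4) h k) h x * (u x * w x)))).
  2: { intros k x; apply (continuous_mult (fun _ => free_cell ts (1 / 4) h k));
       [apply continuous_const|apply Cb]. }
  apply Rle_trans with (sum_below (free_cell ts (1 / 4) h) N * m).
    apply Rmult_le_compat_r.
      assert (H2 := pow2_ge_0 h); unfold m.
      repeat apply Rmult_le_pos; lra.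
    (* At least [N - n = n + 2] cells are free, more than half of them. *)
    apply Rle_trans with (2 := free_cells_count ts (1 / 4) h N Hh).
    fold n; lra.
  rewrite <- sum_below_scal; apply sum_below_le; intros k Hk.
  rewrite (RInt_scal (V := R_CompleteNormedModule)
    (fun x => bump (grid (1 / 4) h k) h x * (u x * w x)))
    by (apply ex_RInt_everywhere; auto).
  apply Rmult_le_compat_l; [apply free_cell_range|].
  assert (Hg : 1 / 4 <= grid (1 / 4) h k /\ grid (1 / 4) h k + h <= 3 / 4).
    rewrite <- grid_succ; unfold grid.
    assert (Hk' : INR (S k) <= INR N) by (apply le_INR; lia).
    assert (Hk0 := pos_INR k); split; nra.
  set (b := grid (1 / 4) h k) in *.
  replace m with ((b + 3 * h / 4 - (b + h / 4)) * (27 / 8192 * h ^ 2 * (A * B / 16)))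
    by (unfold m; field).
  apply RInt_ge_on_subinterval; [apply Cb| |lra|lra|lra|].
    intros x Hx; apply Rmult_le_pos; [apply bump_nonneg|apply Po, Hx].
  intros x Hx; apply Rmult_le_compat.
  - assert (H2 := pow2_ge_0 h); lra.
  - lra.
  - apply bump_lower; assumption.
  - specialize (LA x ltac:(lra)); specialize (LB x ltac:(lra)).
    replace (A * B / 16) with ((A / 4) * (B / 4)) by field.
    apply Rmult_le_compat; lra.
assert (Up : RInt (fun x => u x * w x) 0 1 <= A * B).
  apply Rle_trans with (RInt (fun _ => A * B) 0 1).
    apply RInt_le; [lra| | |].
    - apply ex_RInt_everywhere; exact Co.
    - apply ex_RInt_everywhere; intros; apply continuous_const.
    - intros x Hx; apply Po; unfold unit_interval; lra.
  rewrite (RInt_const (V := R_CompleteNormedModule)).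
  unfold scal; simpl; unfold mult; simpl; lra.
assert (Up0 : 0 <= RInt (fun x => u x * w x) 0 1).
  apply RInt_ge_0; [lra|apply ex_RInt_everywhere; exact Co|].
  intros x Hx; apply Po; unfold unit_interval; lra.
rewrite E in Low.
assert (Em : INR N / 2 * m = (A * B) * (27 / 1048576 * h ^ 2)).
  unfold m; replace (INR N / 2 * (h / 2 * (27 / 8192 * h ^ 2 * (A * B / 16))))
    with (h * INR N * (A * B) * (27 / 524288 * h ^ 2)) by field.
  rewrite EhN; field.
rewrite Em in Low.
assert (H2 : 0 < h ^ 2) by (apply pow_lt; exact Hh0).
assert (HD : 27 / 1048576 * h ^ 2 <= D).
  apply Rmult_le_reg_l with (A * B); [exact HAB|].
  apply Rle_trans with (1 := Low).
  (* Replacing [int u w] by the larger [A B] preserves the inequality only if [D >= 0]. *)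
  assert (HD0 : 0 <= D).
    apply Rnot_lt_le; intros HD.
    assert (0 < A * B * (27 / 1048576 * h ^ 2)) by (apply Rmult_lt_0_compat; lra).
    nra.
  nra.
(* As [h^2 = 1 / (16 (n + 1)^2)], the constant obtained is [27 / 16777216], which exceeds
   [/ 1000000]. *)
apply Rle_trans with (2 := HD).
replace (h ^ 2) with (/ 16 / (INR n + 1) ^ 2)
  by (unfold h; rewrite EN; field; lra).
assert (0 < / (INR n + 1) ^ 2) by (apply Rinv_0_lt_compat, pow_lt; lra).
unfold Rdiv; lra.
Qed.

(** With [X^2 = 1 / eps] the hypothesis yields [X <= 2000 (n + 1)]; the range of [eps] gives
    [X >= 4000], which absorbs the [+ 1] at the price of halving the constant. *)
Lemma gap_count (n : nat) (eps : R) :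
  0 < eps < / 16000000 -> / 1000000 / (INR n + 1) ^ 2 <= 2 * eps ->
  / 4000 * Rpower eps (- (1 / 2)) <= INR n.
Proof.
intros He H; assert (HX := Rpower_half_sq eps (proj1 He)).
set (X := Rpower eps (- (1 / 2))) in *.
assert (X0 : 0 < X) by apply exp_pos.
assert (Hn := pos_INR n).
assert (Hi : 16000000 <= / eps).
  rewrite <- (Rinv_inv 16000000); apply Rinv_le_contravar; lra.
assert (X1 : 4000 <= X) by nra.
assert (Hp : 0 < (INR n + 1) ^ 2) by (apply pow_lt; lra).
apply (proj1 (Rle_div_l _ _ _ Hp)) in H.
assert (Hq : X * X <= 2000000 * (INR n + 1) ^ 2).
  rewrite HX; apply Rmult_le_reg_l with eps; [lra|].
  rewrite Rinv_r by lra; lra.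
assert (X <= 2000 * (INR n + 1)); [|lra].
apply Rnot_lt_le; intros HN; nra.
Qed.

(** * Runs on potentials with the same samples *)

Lemma history_incl (A : algorithm) (q : R -> R) (j k : nat) :
  (j <= k)%nat -> incl (history A q j) (history A q k).
Proof.
intros H; induction H as [|k _ IH]; [apply incl_refl|].
apply incl_tran with (1 := IH); simpl; apply incl_appl, incl_refl.
Qed.

(** Adaptive choices do not separate [q] from [r]: while the answers agree, the next point is the
    same. *)
Lemma history_agree (A : algorithm) (q r : R -> R) (k : nat) :
  (forall t, In t (map fst (history A q k)) -> r t = q t) ->
  forall j, (j <= k)%nat -> history A r j = history A q j.
Proof.
intros H; induction j as [|j IH]; intros Hj; [reflexivity|].
simpl; rewrite IH by lia; rewrite H; [reflexivity|].
apply in_map_iff; exists (next A (history A q j), q (next A (history A q j))).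
split; [reflexivity|].
apply (history_incl A q (S j) k Hj); simpl; apply in_or_app; right; left; reflexivity.
Qed.

Lemma evaluations_agree (A : algorithm) (q r : R -> R) (k : nat) :
  evaluations A q k ->
  (forall t, In t (map fst (history A q k)) -> r t = q t) -> evaluations A r k.
Proof.
intros [S1 L1] H; assert (E := history_agree A q r k H).
split; [rewrite E; auto|intros j Hj; rewrite E by lia; auto].
Qed.

(** The counterpart, for programs, of the sample points in a [history], along the branch actually
    taken. *)
Fixpoint query_points (P : program) (q : R -> R) (s : memory) : list R :=
  match P with
  | Return a => []
  | Arith o d a b k => query_points k q (write s d (arith_val o (read s a) (read s b)))
  | Elem f d a k => query_points k q (write s d (elem_val f (read s a)))
  | Query d t k => read s t :: query_points k q (write s d (q (read s t)))
  | IfLe a b kle kgt =>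
      if Rle_dec (read s a) (read s b) then query_points kle q s
      else query_points kgt q s
  end.

Lemma query_points_length (P : program) (q : R -> R) (s : memory) :
  length (query_points P q s) = queries (exec P q s).
Proof.
revert s; induction P as [a|o d a b k IH|f d a k IH|d t k IH|a b k1 IH1 k2 IH2];
  intros s; simpl; auto.
destruct (Rle_dec _ _); auto.
Qed.

Lemma exec_agree (P : program) (q r : R -> R) (s : memory) :
  (forall t, In t (query_points P q s) -> r t = q t) -> exec P r s = exec P q s.
Proof.
revert s; induction P as [a|o d a b k IH|f d a k IH|d t k IH|a b k1 IH1 k2 IH2];
  intros s H; simpl in *; [reflexivity| | | |].
- rewrite IH; auto.
- rewrite IH; auto.
- rewrite (H (read s t)) by auto; rewrite IH; auto.
- destruct (Rle_dec _ _); [rewrite IH1|rewrite IH2]; auto.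
Qed.

(* The value [v] is shared by the zero potential and the adversary. *)
Lemma indistinguishable_count (phi : (R -> R) -> R -> Prop) (eps v : R) (ts : list R) :
  0 < eps < / 16000000 -> Rbar_le (worst_error phi) eps ->
  (forall q, (forall t, In t ts -> q t = 0) -> phi q v) ->
  / 4000 * Rpower eps (- (1 / 2)) <= INR (length ts).
Proof.
intros He Herr H; apply gap_count; [exact He|].
destruct (lambda_gap ts) as [q [Hq [Z G]]]; apply Rle_trans with (1 := G).
assert (A := worst_error_ge phi eps q v Herr Hq (H q Z)).
assert (B := worst_error_ge phi eps (fun _ => 0) v Herr classQ_zero
  (H _ (fun _ _ => eq_refl))).
apply Rabs_le_between in A; apply Rabs_le_between in B; lra.
Qed.

(** The run on the zero potential alone forces the bound, as its number of samples is at most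
    [n]. *)
Lemma nwor_ge (eps : R) :
  0 < eps < / 16000000 -> Rbar_le (/ 4000 * Rpower eps (- (1 / 2))) (nwor eps).
Proof.
intros He; apply (proj2 (Glb_Rbar_correct _)); intros x [A [n [[Hn _] [Herr ->]]]].
destruct (Hn _ classQ_zero) as [k [Hkn Hk]]; simpl.
apply Rle_trans with (INR k); [|apply le_INR, Hkn].
set (ts := map fst (history A (fun _ => 0) k)).
replace k with (length ts) by (unfold ts; rewrite length_map; apply history_length).
apply (indistinguishable_count (alg_value A) eps
  (combine A (map snd (history A (fun _ => 0) k)))); [exact He|exact Herr|].
intros q Z; exists k; split.
  apply evaluations_agree with (fun _ => 0); assumption.
rewrite (history_agree A (fun _ => 0) q k Z k (Nat.le_refl k)); reflexivity.
Qed.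

Lemma comp_wor_ge (c eps : R) :
  0 < c -> 0 < eps < / 16000000 ->
  Rbar_le (/ 4000 * (c * Rpower eps (- (1 / 2)))) (comp_wor c eps).
Proof.
intros Hc He; apply (proj2 (Glb_Rbar_correct _)); intros x [P [_ [Herr Hcost]]]; simpl.
set (z := fun _ : R => 0).
assert (Hx : c * INR (queries (run P z)) + INR (operations (run P z)) <= x).
  change (Rbar_le (c * INR (queries (run P z)) + INR (operations (run P z))) x).
  rewrite <- Hcost; apply (proj1 (Lub_Rbar_correct _)).
  exists z; split; [apply classQ_zero|reflexivity].
assert (Hq : / 4000 * Rpower eps (- (1 / 2)) <= INR (queries (run P z))).
  unfold run; rewrite <- query_points_length.
  apply (indistinguishable_count (prog_value P) eps (value (run P z))); auto.
  intros q Z; unfold prog_value, run; rewrite (exec_agree P z q); auto.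
assert (Hop := pos_INR (operations (run P z))).
assert (c * (/ 4000 * Rpower eps (- (1 / 2))) <= c * INR (queries (run P z)))
  by (apply Rmult_le_compat_l; lra).
lra.
Qed.

Theorem theorem4p2 :
  (exists C1 C2 eps0 : R, 0 < C1 /\ 0 < C2 /\ 0 < eps0 /\
    forall eps : R, 0 < eps < eps0 ->
      Rbar_le (C1 * Rpower eps (- (1 / 2))) (nwor eps) /\
      Rbar_le (nwor eps) (C2 * Rpower eps (- (1 / 2)))) /\
  (exists C1 eps0 : R, 0 < C1 /\ 0 < eps0 /\
    forall c eps : R, 0 < c -> 0 < eps < eps0 ->
      Rbar_le (C1 * (c * Rpower eps (- (1 / 2)))) (comp_wor c eps)) /\
  (exists C2 eps0 : R, 0 < C2 /\ 0 < eps0 /\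
    forall c eps : R, 0 < c -> 0 < eps < eps0 ->
      Rbar_le (comp_wor c eps)
        (C2 * (c * Rpower eps (- (1 / 2)) +
               Rpower eps (- (1 / 2)) * log2 (/ eps)))).
Proof.
split; [|split].
- exists (/ 4000), 3, (/ 16000000); do 3 (split; [lra|]); intros eps He.
  split; [apply nwor_ge, He|].
  destruct (grid_size eps) as [n [Hn [Hh HS]]]; [lra|].
  apply Rbar_le_trans with (INR (S n)); [apply nwor_le; [exact Hn|lra]|exact HS].
- exists (/ 4000), (/ 16000000); do 2 (split; [lra|]).
  intros c eps Hc He; apply comp_wor_ge; assumption.
(* 12 is 3 times 4: at most [3 X] samples, each rounded with at most [4 * log2 (/ eps)]
   comparisons. *)
- exists 12, (1 / 2); do 2 (split; [lra|]); intros c eps Hc He.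
  destruct (grid_size eps He) as [n [Hn [Hh HS]]].
  destruct (rounding_depth eps He) as [M [HM HL]].
  apply Rbar_le_trans with (c * INR (S n) + INR (S n) * INR M).
    apply comp_wor_le; [exact Hn|lra].
  assert (HM0 := pos_INR M); assert (HS0 := pos_INR (S n)).
  set (X := Rpower eps (- (1 / 2))) in *.
  change (c * INR (S n) + INR (S n) * INR M <= 12 * (c * X + X * log2 (/ eps))).
  assert (INR (S n) * INR M <= 3 * X * (4 * log2 (/ eps)))
    by (apply Rmult_le_compat; assumption).
  assert (c * INR (S n) <= c * (3 * X)) by (apply Rmult_le_compat_l; lra).
  assert (0 < c * X) by (apply Rmult_lt_0_compat; [exact Hc|apply exp_pos]).
  lra.
Qed.
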